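(* Suppose $\pi$ is a finitely generated (not necessarily abelian) group, and $\varphi\colon\pi\to\pi$ is a monomorphism with $[\pi:\mathrm{im}\,\varphi]>1$. Suppose $G:=\bigcap_{k=1}^{\infty}\mathrm{im}\,\varphi^{k}$ is normal in $\pi$ and $\pi/G$ is abelian. Then $\pi/G\cong\mathbb{Z}^{n}$ for some $n>0$, $[\pi:\mathrm{im}\,\varphi]<\infty$, and the abelianization $G/[G,G]$ is finitely generated.
   Context: $\varphi^k$ denotes the $k$-fold iterate of $\varphi$. The index $[\pi:\mathrm{im}\,\varphi]$ is not assumed finite a priori. *)

(* Defs.v *)
From HB Require Import structures.
From mathcomp Require Import all_boot ssralg ssrint matrix.
From mathcomp Require Import boolp classical_sets functions cardinality.

Set Implicit Arguments.
Unset Strict Implicit.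
Unset Printing Implicit Defensive.

Local Open Scope classical_set_scope.
Local Open Scope group_scope.

(* Throughout, a subgroup of a (possibly infinite) group G is a predicate     *)
(* carrying the library structure [groupClosed G], and a group homomorphism   *)
(* is a [UMagmaMorphism.type G H].                                            *)

Section Subgroups.
Variable G : groupType.

Definition gen_subgroup (A : set G) : {pred G} :=
  [in smallest [set H : set G | group_closed [in H]] A].

Lemma gen_subgroupP (A : set G) (x : G) :
  x \in gen_subgroup A <->
  forall H : set G, group_closed [in H] -> A `<=` H -> H x.
Proof.
split=> [/set_mem xA H cH AH|xA]; first exact: (xA H (conj cH AH)).
by apply/mem_set => H [cH AH]; exact: xA.
Qed.

Lemma gen_subgroup_closed (A : set G) : group_closed (gen_subgroup A).
Proof.
split=> [|x y /gen_subgroupP xA /gen_subgroupP yA].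
  by apply/gen_subgroupP => H [/set_mem].
apply/gen_subgroupP => H cH AH; apply: set_mem.
by apply: cH.2; apply: mem_set; [exact: xA | exact: yA].
Qed.

(* HB only infers the joined [groupClosed] instance when [isMulClosed] is     *)
(* declared before [isMul1Closed].                                            *)
HB.instance Definition _ (A : set G) :=
  isMulClosed.Build G (gen_subgroup A) (group_closedM (gen_subgroup_closed A)).
HB.instance Definition _ (A : set G) :=
  isMul1Closed.Build G (gen_subgroup A) (gen_subgroup_closed A).1.
HB.instance Definition _ (A : set G) :=
  isInvClosed.Build G (gen_subgroup A) (group_closedV (gen_subgroup_closed A)).

Definition normal_subgroup (N : {pred G}) : Prop :=
  {in N, forall x (y : G), x ^ y \in N}.

Definition left_cosets (H : set G) : set (set G) :=
  [set [set x * h | h in H] | x in [set: G]].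

Definition derived_subgroup : {pred G} :=
  gen_subgroup [set [~ x, y] | x in [set: G] & y in [set: G]].
HB.instance Definition _ := GroupClosed.on derived_subgroup.

Lemma derived_subgroup_normal : normal_subgroup derived_subgroup.
Proof.
move=> x xD y; rewrite -[x ^ y](mulVKg x) -commgEl gpredM//.
by apply/gen_subgroupP => H _; apply; exists x => //; exists y.
Qed.

Definition subgroup_type (S : groupClosed G) := {x : G | x \in S}.
HB.instance Definition _ (S : groupClosed G) := SubChoice.on (subgroup_type S).

Lemma subgroup_closed (S : groupClosed G) : group_closed [in S].
Proof. by split; [exact: gpred1 | exact: gpredF]. Qed.

HB.instance Definition _ (S : groupClosed G) :=
  SubChoice_isSubGroup.Build G [in S] (subgroup_type S) (subgroup_closed S).

End Subgroups.

Definition finitely_generated (G : groupType) : Prop :=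
  exists s : seq G, forall x : G, x \in gen_subgroup [set` s].

Definition abelian_group (G : groupType) : Prop :=
  forall x y : G, commute x y.

Definition isomorphic (G H : groupType) : Prop :=
  exists f : UMagmaMorphism.type G H, bijective f.

Section Quotient.
Local Open Scope quotient_scope.
Variables (G : groupType) (N : groupClosed G) (nN : normal_subgroup N).

(* [coset_rel nN x y] says that xN = yN. The normality proof is an argument   *)
(* only so that the group structure on [quotient_group nN] can refer to it.   *)
Definition coset_rel of normal_subgroup N : rel G := fun x y => x^-1 * y \in N.

Lemma coset_rel_equiv : equiv_class_of (coset_rel nN).
Proof.
split=> [x|x y|y x z]; rewrite /coset_rel ?mulVg ?gpred1//.
  by rewrite -[in RHS]gpredV invgM invgK.
by move=> xy yz; rewrite -[z](mulVKg y) mulgA gpredM.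
Qed.

Canonical coset_rel_equivRel := EquivRelPack coset_rel_equiv.
Canonical coset_rel_encModRel := defaultEncModRel (coset_rel nN).

Definition quotient_group := {eq_quot coset_rel nN}.
HB.instance Definition _ : EqQuotient G (coset_rel nN) quotient_group :=
  EqQuotient.on quotient_group.
HB.instance Definition _ := Choice.on quotient_group.

Lemma quotient_eqE (x y : G) :
  (x == y %[mod quotient_group]) = (x^-1 * y \in N).
Proof. by rewrite piE. Qed.

Definition quotient_one : quotient_group := lift_cst quotient_group 1.
Definition quotient_mul := lift_op2 quotient_group *%g.
Definition quotient_inv := lift_op1 quotient_group (@monoid.inv G).

Canonical pi_quotient_one := PiConst quotient_one.

Lemma pi_quotient_invM :
  {morph \pi_quotient_group : x / x^-1 >-> quotient_inv x}.
Proof.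
move=> x; unlock quotient_inv; apply/eqP; rewrite quotient_eqE invgK.
set y := repr _; have : x^-1 * y \in N by rewrite -quotient_eqE reprK.
rewrite -gpredV invgM invgK => /nN/(_ y^-1).
by rewrite conjgE invgK -!mulgA mulVKg.
Qed.
Canonical pi_quotient_inv := PiMorph1 pi_quotient_invM.

Lemma pi_quotient_mulM :
  {morph \pi_quotient_group : x y / x * y >-> quotient_mul x y}.
Proof.
move=> x y; unlock quotient_mul; apply/eqP; rewrite quotient_eqE.
set x' := repr (\pi x); set y' := repr (\pi y).
have x'N : x^-1 * x' \in N by rewrite -quotient_eqE reprK.
have y'N : y^-1 * y' \in N by rewrite -quotient_eqE reprK.
have -> : (x * y)^-1 * (x' * y') = (x^-1 * x') ^ y * (y^-1 * y').
  by rewrite conjgE invgM -!mulgA mulVKg.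
by rewrite gpredM// nN.
Qed.
Canonical pi_quotient_mul := PiMorph2 pi_quotient_mulM.

Lemma quotient_mulA : associative quotient_mul.
Proof. by move=> x y z; rewrite -[x]reprK -[y]reprK -[z]reprK !piE mulgA. Qed.
Lemma quotient_mul1g : left_id quotient_one quotient_mul.
Proof. by move=> x; rewrite -[x]reprK !piE mul1g. Qed.
Lemma quotient_mulg1 : right_id quotient_one quotient_mul.
Proof. by move=> x; rewrite -[x]reprK !piE mulg1. Qed.
Lemma quotient_mulVg : left_inverse quotient_one quotient_inv quotient_mul.
Proof. by move=> x; rewrite -[x]reprK !piE mulVg. Qed.
Lemma quotient_mulgV : right_inverse quotient_one quotient_inv quotient_mul.
Proof. by move=> x; rewrite -[x]reprK !piE mulgV. Qed.

HB.instance Definition _ := isGroup.Build quotient_group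
  quotient_mulA quotient_mul1g quotient_mulg1 quotient_mulVg quotient_mulgV.

End Quotient.

Definition abelianization (G : groupType) : groupType :=
  quotient_group (@derived_subgroup_normal G).

Definition free_abelian (n : nat) : groupType := Algebra.to_multiplicative 'rV[int]_n.

Section StableImage.
Variables (G : groupType) (phi : UMagmaMorphism.type G G).

Definition stable_image : {pred G} :=
  [in \bigcap_(k in [set k | 0 < k]%N) range (iter k phi)].

Lemma stable_image_closed : group_closed stable_image.
Proof.
have iter1 k : iter k phi 1 = 1 by elim: k => //= k ->; rewrite gmulf1.
have iterF k : {morph iter k phi : x y / x / y}.
  by elim: k => // k IH x y; rewrite !iterS IH gmulfF.
split=> [|x y /set_mem xS /set_mem yS]; apply/mem_set => k k0.
  by exists 1; rewrite ?iter1.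
have [[u _ <-] [v _ <-]] := (xS k k0, yS k k0).
by exists (u / v); rewrite ?iterF.
Qed.

HB.instance Definition _ :=
  isMulClosed.Build G stable_image (group_closedM stable_image_closed).
HB.instance Definition _ :=
  isMul1Closed.Build G stable_image stable_image_closed.1.
HB.instance Definition _ :=
  isInvClosed.Build G stable_image (group_closedV stable_image_closed).

End StableImage.

(* Main.v *)
Require Import Defs.
From HB Require Import structures.
From mathcomp Require Import all_boot all_order all_algebra all_field.
From mathcomp Require Import boolp classical_sets functions cardinality zify.

(** Let [S] be the stable image, the intersection of the images of the iterates
    of [phi]. As [phi] is injective, it restricts to an automorphism of [S] and
    induces an injective endomorphism of the finitely generated abelian group
    [A = pi / S], whose iterated images have trivial intersection. A torsion
    element of [A] has a finite orbit, so it is periodic and lies in all these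
    images: hence [A] is torsion-free, [A = Z^n], and [phi] induces an integral
    matrix [F] with nonzero determinant ([class_map_ex]). The index of the image
    of [phi] is the absolute value of this determinant, and [n = 0] would make
    [phi] onto.

    The abelianization [M] of [S] is a finitely generated [Z[A]]-module under
    conjugation, and [phi] gives a bijection [psi] of [M] which is semilinear:
    [psi (u m) = (u F) (psi m)]. Conjugating the action by the powers of [psi]
    extends it to the direct limit of [A -> A -> ...] along [F]. This limit has
    no nonzero homomorphism to [Z]: such a homomorphism would restrict to a
    functional on [Z^n] infinitely divisible by [F], and an endomorphism with
    trivial stable image has no nonzero one ([divisible_functional_eq0]).

    Suppose that some generator [a] of [A] acts transcendentally over the prime
    field on [M] extended to the rationals, or on [M / p M]. Turning a maximal
    independent set of generators, containing [a], into indeterminates and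
    inverting the nonzero polynomials in them makes [M] a nonzero
    finite-dimensional vector space over a field of rational functions, with an
    action of the limit group. The degree in [a] of the determinant is then a
    homomorphism from the limit group to [Z] which is positive on [a]: a
    contradiction ([no_valued_scalar], [generators_algebraic]).

    So every generator acts algebraically, and these vector spaces are
    finite-dimensional over the prime field. On [M / p M] every generator then
    satisfies some ['X^N - 1]. In characteristic 0 the joint eigenvalues of [A]
    form a finite set of characters stable under composition with [F]; they have
    finite order, and every generator satisfies a product of polynomials
    ['X^N - 1] up to torsion. The two combine into an integral equation with unit
    leading and constant coefficients for each generator acting on [M]; therefore
    [M] is spanned over [Z] by finitely many elements ([finitely_generated_of_shift]). *)

Set Implicit Arguments.
Unset Strict Implicit.
Unset Printing Implicit Defensive.

Import Order.TTheory GRing.Theory Num.Theory.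
Local Open Scope ring_scope.

(** * Subgroups of Z^n and endomorphisms with trivial stable image *)

(** Induction on [n]: an element of [H] whose first coordinate has least
    nonzero absolute value reduces [H] to its elements with first coordinate 0. *)
Lemma subgroup_row_span n (H : 'rV[int]_n -> Prop) :
  H 0 -> (forall x y, H x -> H y -> H (x - y)) ->
  exists r (B : 'M[int]_(r, n)),
    (forall i, H (row i B)) /\ (forall x, H x -> exists c : 'rV_r, x = c *m B).
Proof.
elim: n H => [|n IHn] H H0 HB.
  exists 0%N, 0; split=> [[]//|x _]; exists 0.
  by rewrite [x]thinmx0 [RHS]thinmx0.
have HN x : H x -> H (- x) by move=> Hx; rewrite -sub0r; apply: HB.
have HD x y : H x -> H y -> H (x + y).
  by move=> Hx Hy; rewrite -[y]opprK; apply: HB => //; apply: HN.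
have HZ (k : int) x : H x -> H (k *: x).
  move=> Hx; case: k => k.
    by elim: k => [|k IH]; rewrite ?scale0r// intS scalerDl scale1r; apply: HD.
  rewrite NegzE scaleNr; apply: HN.
  by elim: k.+1 => [|m IH]; rewrite ?scale0r// intS scalerDl scale1r; apply: HD.
have lsub0 (x : 'rV[int]_(1 + n)) : x 0 0 = 0 -> lsubmx x = 0.
  move=> x00; apply/rowP => i; rewrite ord1 !mxE -[RHS]x00; congr (x _ _).
  exact: val_inj.
pose K (v : 'rV[int]_n) := H (@row_mx _ 1 1 n 0 v).
have [r [B [HB1 HB2]]] : exists r (B : 'M[int]_(r, n)),
    (forall i, K (row i B)) /\ (forall x, K x -> exists c : 'rV_r, x = c *m B).
  apply: IHn => [|x y Kx Ky]; first by rewrite /K row_mx0.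
  by rewrite /K -[0 as X in row_mx X](subr0 0) -add_row_mx -opp_row_mx; apply: HB.
have [[x0 Hx0 x0n0]|Hz] := pselect (exists2 x, H x & x 0 0 != 0); last first.
  exists r, (row_mx (0 : 'M_(r, 1)) B : 'M_(r, n.+1)); split=> [i|x Hx].
    by rewrite [row i _](row_row_mx i (0 : 'M_(r, 1)) B) row0; apply: HB1.
  have x00 : lsubmx (x : 'rV_(1 + n)) = 0.
    apply: lsub0; apply/eqP/negPn/negP => x0n; apply: Hz; by exists x.
  have [c cE] : exists c : 'rV_r, rsubmx (x : 'rV_(1 + n)) = c *m B.
    by apply: HB2; rewrite /K -x00 hsubmxK.
  by exists c; rewrite [RHS](@mul_mx_row _ _ _ 1 n c 0 B) mulmx0 -cE -x00 hsubmxK.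
have [d d0 [[x Hx xd] dmin]] : exists2 d, (0 < d)%N &
   (exists2 x, H x & absz (x 0 0) = d) /\
   (forall x, H x -> x 0 0 != 0 -> (d <= absz (x 0 0)%R)%N).
  have ex : exists d, (fun d => `[< exists x, [/\ H x, x 0 0 != 0 & absz (x 0 0) = d] >]) d.
    by exists (absz (x0 0 0)); apply/asboolP; exists x0.
  case: (ex_minnP ex) => d /asboolP[x [Hx xn0 xd]] dmin; exists d.
    by rewrite -xd lt0n absz_eq0.
  split; first by exists x.
  by move=> y Hy yn0; apply: dmin; apply/asboolP; exists y.
exists (1 + r)%N, (col_mx x (row_mx (0 : 'M_(r, 1)) B : 'M_(r, 1 + n))); split=> [i|y Hy].
  case: (split_ordP i) => j ->.
    by rewrite ord1 rowKu -[row _ _]/(row 0 x) row_id.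
  by rewrite rowKd [row _ _](row_row_mx j (0 : 'M_(r, 1)) B) row0; apply: HB1.
pose q := divz (y 0 0) (x 0 0).
have Hq : H (y - q *: x) by apply: HB => //; apply: HZ.
have q0 : (y - q *: x) 0 0 = 0.
  apply/eqP/negPn/negP => /(dmin _ Hq); rewrite !mxE.
  have -> : y 0 0 - q * x 0 0 = modz (y 0 0) (x 0 0) by rewrite /modz.
  have xn0 : x 0 0 != 0 by rewrite -absz_eq0 xd -lt0n.
  rewrite -xd leqNgt => /negP; apply.
  move: (modz_ge0 (y 0 0) xn0) (ltz_mod (y 0 0) xn0); move: (modz _ _) => z.
  by move: z => [] // k _; rewrite -abszE ltz_nat.
have l0 : lsubmx (y - q *: x : 'rV_(1 + n)) = 0.
  exact: lsub0.
have [c cE] : exists c : 'rV_r, rsubmx (y - q *: x : 'rV_(1 + n)) = c *m B.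
  by apply: HB2; rewrite /K -l0 hsubmxK.
exists (row_mx q%:M c); rewrite mul_row_col mul_scalar_mx (@mul_mx_row _ _ _ 1 n c 0 B).
rewrite mulmx0 -cE -l0 hsubmxK.
by rewrite addrC subrK.
Qed.

(** The form in which the ascending chain condition for subgroups of Z^n is
    used: the span of the whole sequence is finitely generated, hence is already
    the span of finitely many terms. *)
Lemma int_row_dependent n (u : nat -> 'rV[int]_n) :
  exists K (c : 'I_K -> int), u K = \sum_(i < K) c i *: u i.
Proof.
pose H x := exists K (c : nat -> int), x = \sum_(i < K) c i *: u i.
have grow K L (c : nat -> int) : (K <= L)%N ->
    \sum_(i < K) c i *: u i = \sum_(i < L) (if (i < K)%N then c i else 0) *: u i.
  move=> KL; rewrite (big_ord_widen _ (fun i => c i *: u i) KL) big_mkcond.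
  by apply: eq_bigr => i _; case: ifP => // _; rewrite scale0r.
have [||r [B [HB1 HB2]]] := @subgroup_row_span n H.
- by exists 0%N, (fun=> 0); rewrite big_ord0.
- move=> x y [K [c ->]] [L [d ->]]; exists (maxn K L).
  exists (fun i => (if (i < K)%N then c i else 0) - (if (i < L)%N then d i else 0)).
  rewrite (grow _ _ _ (leq_maxl K L)) (grow _ _ _ (leq_maxr K L)) -sumrB.
  by apply: eq_bigr => i _; rewrite scalerBl.
have /boolp.choice[K /boolp.choice[c cE]] : forall i, H (row i B) := HB1.
pose L := (\max_i K i)%N.
have HL : H (u L).
  exists L.+1, (fun i => (i == L)%:R).
  rewrite (bigD1 ord_max)//= eqxx scale1r big1 ?addr0// => i ni.
  by rewrite (negPf (_ : val i != L)) ?scale0r//; apply: contraNneq ni => e; apply/eqP/val_inj.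
have [x xE] := HB2 _ HL; exists L.
exists (fun j => \sum_i x 0 i * (if (j < K i)%N then c i j else 0)).
rewrite xE mulmx_sum_row; under [RHS]eq_bigr do rewrite scaler_suml.
rewrite exchange_big; apply: eq_bigr => i _.
by rewrite cE (grow (K i) L) ?leq_bigmax// scaler_sumr; apply: eq_bigr => j _; rewrite scalerA.
Qed.

Definition contracting n (F : 'M[int]_n) :=
  forall x : 'rV_n, (forall k, exists y, x = y *m F ^+ k) -> x = 0.

(** A functional that is infinitely divisible along [F] vanishes. The chain
    condition gives [h K = F Q (h K)] with [Q] an integral polynomial in [F], so
    [1 - F Q] is singular; a row vector [x = x F Q] that it kills satisfies
    [x = (x Q ^ k) F ^ k] for all [k], against contraction. Integrality of [Q] is
    what the chain condition adds to linear dependence over the rationals. *)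
Lemma divisible_functional_eq0 n (F : 'M[int]_n) (h : nat -> 'cV[int]_n) :
  contracting F -> (forall k, F *m h k.+1 = h k) -> h 0%N = 0.
Proof.
have FS k : F ^+ k.+1 = F *m F ^+ k := exprS F k.
have FSr k : F ^+ k.+1 = F ^+ k *m F := exprSr F k.
move=> Fcap hF; have hK k j : h k = F ^+ j *m h (k + j)%N.
  elim: j k => [|j IH] k; first by rewrite expr0 mul1mx addn0.
  by rewrite FS addnS -addSn -mulmxA -IH hF.
have [K [c hc]] := int_row_dependent (fun k => (h k)^T).
have [hK0|hK0] := eqVneq (h K) 0; first by rewrite (hK _ K) add0n hK0 mulmx0.
pose Q := \sum_(i < K) c i *: F ^+ (K - i.+1).
have QF : Q *m F = F *m Q.
  rewrite mulmx_suml mulmx_sumr; apply: eq_bigr => i _.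
  by rewrite -scalemxAl -scalemxAr -FS -FSr.
have hQ : (1%:M - F *m Q) *m h K = 0.
  rewrite mulmxBl mul1mx -[h K in X in X - _]trmxK hc mulmx_sumr mulmx_suml linear_sum -sumrB.
  apply: big1 => i _; rewrite linearZ /= trmxK -scalemxAr -scalemxAl -FS.
  by rewrite -subSn// subSS (hK i (K - i)%N) subnKC ?subrr// ltnW.
have /eqP/det0P[x x0 xQ] : \det (1%:M - F *m Q) = 0.
  rewrite -det_tr; apply/eqP/det0P; exists (h K)^T; last by rewrite -trmx_mul hQ trmx0.
  by rewrite trmx_eq0.
have {}xQ : x = x *m Q *m F.
  by move/eqP: xQ; rewrite mulmxBr mulmx1 subr_eq0 -QF mulmxA => /eqP.
case/eqP: x0; apply: Fcap => k; exists (x *m Q ^+ k).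
elim: k => [|k IH]; first by rewrite !expr0 !mulmx1.
have QFk : Q *m F ^+ k = F ^+ k *m Q by apply: commrX.
rewrite [Q ^+ _]exprSr FSr -[Q ^+ k * Q]/(Q ^+ k *m Q) !mulmxA.
by rewrite -(mulmxA _ Q (F ^+ k)) QFk !mulmxA -IH.
Qed.

Lemma pigeonhole_nat (T : finType) (d : nat -> T) : exists i j, (i < j)%N /\ d i = d j.
Proof.
apply: contrapT => nd; have dinj : injective (fun i : 'I_#|T|.+1 => d i).
  move=> i j dij; apply/val_inj/eqP/negPn/negP => ij; apply: nd.
  by move: ij; rewrite neq_ltn => /orP[] ij; [exists i, j|exists j, i].
by have := leq_card _ dinj; rewrite card_ord ltnn.
Qed.

Definition int_span (U : zmodType) (I : finType) (g : I -> U) (x : U) :=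
  exists c : I -> int, x = \sum_i g i *~ c i.

Lemma int_span0 (U : zmodType) (I : finType) (g : I -> U) : int_span g 0.
Proof. by exists (fun=> 0); rewrite big1. Qed.

Lemma int_spanB (U : zmodType) (I : finType) (g : I -> U) x y :
  int_span g x -> int_span g y -> int_span g (x - y).
Proof.
move=> [a ->] [b ->]; exists (fun i => a i - b i); rewrite -sumrB.
by apply: eq_bigr => i _; rewrite mulrzBr.
Qed.

Lemma int_span_mem (U : zmodType) (I : finType) (g : I -> U) i : int_span g (g i).
Proof.
exists (fun j => (j == i)%:R); rewrite (bigD1 i)//= eqxx big1 ?addr0// => j /negPf->.
by rewrite mulr0z.
Qed.

(** Descent: as long as two coefficients of a relation are nonzero, a change
    of generators subtracts one from the other and shrinks the relation; once a
    single coefficient is left, torsion-freeness kills a generator. *)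
Lemma torsion_free_basis (U : zmodType) m (g : 'I_m -> U) :
  (forall x, int_span g x) ->
  (forall (x : U) (k : int), k != 0 -> x *~ k = 0 -> x = 0) ->
  exists n (e : 'I_n -> U), (forall x, int_span e x) /\
    (forall c : 'I_n -> int, \sum_i e i *~ c i = 0 -> forall i, c i = 0).
Proof.
move=> + tf; elim: m g => [|m IHm] g gen.
  by exists 0%N, g; split=> // c _ [].
have [ind|/existsNP[c /not_implyP[cg /existsNP[i0 /eqP ci0]]]] :=
  pselect (forall c : 'I_m.+1 -> int, \sum_i g i *~ c i = 0 -> forall i, c i = 0).
  by exists m.+1, g.
have [k ck] := ubnP (\sum_i absz (c i)); elim: k => // k IHk in g gen c cg i0 ci0 ck *.
have [[[i j] /= [ij ci cj cij]]|noij] := pselect (exists ij : 'I_m.+1 * 'I_m.+1,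
    [/\ ij.1 != ij.2, c ij.1 != 0, c ij.2 != 0 & (absz (c ij.2) <= absz (c ij.1))%N]).
  (* [g'] is the generating family for which the coordinates change by [up]. *)
  pose eps := Num.sg (c i) * Num.sg (c j).
  pose g' k := if k == j then g j + g i *~ eps else g k.
  pose up (d : 'I_m.+1 -> int) k := if k == i then d i - eps * d j else d k.
  have gg' d : \sum_k g k *~ d k = \sum_k g' k *~ up d k.
    rewrite (bigD1 i)//= (bigD1 j) 1?eq_sym//= [RHS](bigD1 i)//= [in RHS](bigD1 j) 1?eq_sym//=.
    have ji : (j == i) = false by rewrite eq_sym (negPf ij).
    rewrite !addrA /g' /up (negPf ij) ji !eqxx.
    congr (_ + _).
      by rewrite mulrzBr mulrzDl -mulrzA addrA addrAC subrK.
    by apply: eq_bigr => l /andP[/negPf-> /negPf->].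
  have ji : (j == i) = false by rewrite eq_sym (negPf ij).
  apply: (IHk g' _ (up c) _ j).
  - by move=> x; have [d ->] := gen x; exists (up d); rewrite gg'.
  - by rewrite -gg'.
  - by rewrite /up ji.
  - rewrite -ltnS; apply: leq_trans ck; rewrite ltnS (bigD1 i)//= [X in (_ < X)%N](bigD1 i)//=.
    rewrite /up eqxx (eq_bigr (fun i => absz (c i))) => [|l /negPf-> //].
    rewrite ltn_add2r /eps; move: ci cj cij.
    by case: (sgrP (c i)); case: (sgrP (c j)); lia.
have g0 : g i0 = 0.
  apply: (tf _ _ ci0); rewrite -[RHS]cg (bigD1 i0)//= big1 ?addr0// => j ji.
  have [->|cj] := eqVneq (c j) 0; first by rewrite mulr0z.
  case: noij; have [le|/ltnW le] := leqP (absz (c i0)) (absz (c j)).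
    by exists (j, i0).
  by exists (i0, j); split; rewrite // eq_sym.
apply: (IHm (fun i => g (lift i0 i))) => x; have [d ->] := gen x.
by exists (fun i => d (lift i0 i)); rewrite (bigD1_ord i0)//= g0 mul0rz add0r.
Qed.

(** The iterates of a torsion element [x] are combinations of finitely many
    of them with coefficients modulo the order of [x], so they take finitely many
    values; as [f] is injective, [x] is periodic and lies in every image. *)
Lemma torsion_free_of_shift (U : zmodType) m (g : 'I_m -> U) (f : {additive U -> U}) :
  (forall x, int_span g x) -> injective f ->
  (forall x, (forall k, exists y, x = iter k f y) -> x = 0) ->
  forall (x : U) (k : int), k != 0 -> x *~ k = 0 -> x = 0.
Proof.
move=> gen finj fcap x N N0 xN; apply: fcap.
have injk k : injective (iter k f) by elim: k => // k IH y z /= /finj/IH.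
pose u k : 'rV[int]_m := \row_i projT1 (cid (gen (iter k f x))) i.
have uE k : iter k f x = \sum_i g i *~ u k 0 i.
  by rewrite [LHS](projT2 (cid (gen (iter k f x)))); apply: eq_bigr => i _; rewrite mxE.
have [K [c uK]] := int_row_dependent u.
have fK : iter K f x = \sum_(i < K) iter i f x *~ c i.
  rewrite uE uK; under [RHS]eq_bigr do rewrite uE mulrz_suml.
  rewrite exchange_big; apply: eq_bigr => i _.
  rewrite summxE mulrz_sumr; apply: eq_bigr => j _.
  by rewrite mxE mulrC mulrzA.
have fD k : {morph iter k f : y z / y + z} by elim: k => // k IH y z; rewrite !iterS IH raddfD.
have fMz k y z : iter k f (y *~ z) = iter k f y *~ z.
  by elim: k => // k IH; rewrite !iterS IH raddfMz.
have iN k : iter k f x *~ N = 0.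
  by rewrite -fMz xN; elim: k => //= k ->; rewrite raddf0.
pose T := {ffun 'I_K -> 'I_(absz N)}.
have fin k : exists d : T, iter k f x = \sum_(i < K) iter i f x *~ (val (d i)).
  have red (e : 'I_K -> int) : exists d : T, \sum_(i < K) iter i f x *~ e i =
       \sum_(i < K) iter i f x *~ (val (d i)).
    have lt (z : int) : (absz (z %% N)%Z < absz N)%N.
      move: (modz_ge0 z N0) (ltz_mod z N0); move: (modz _ _).
      by move=> t; lia.
    exists [ffun i => Ordinal (lt (e i))]; apply: eq_bigr => i _; rewrite ffunE /=.
    rewrite gez0_abs ?modz_ge0// {1}(divz_eq (e i) N) mulrzDr mulrC mulrzA iN.
    by rewrite mul0rz add0r.
  elim: k => [|k [d dE]].
    case: K @T c uK fK red => [|K] T c uK fK red.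
      have N1 : (0 < absz N)%N by rewrite lt0n absz_eq0.
      by rewrite /= in fK *; exists [ffun=> Ordinal N1]; rewrite fK !big_ord0.
    have [d dE] := red (fun i => (i == 0)%:R); exists d; rewrite -dE.
    by rewrite (bigD1 ord0)//= big1 ?addr0// => i /negPf->.
  have [d' d'E] : exists d' : 'I_K -> int, iter k.+1 f x = \sum_(i < K) iter i f x *~ d' i.
    case: K @T c uK fK red d dE => [|K] T c uK fK red d dE.
      by exists (fun=> 0); rewrite iterS dE !big_ord0 raddf0.
    exists (fun i : 'I_K.+1 =>
      (if i == 0 then 0 else (val (d (inord i.-1)) : int)) + c i * val (d ord_max)).
    rewrite iterS dE raddf_sum /= big_ord_recr /= raddfMz -iterS fK.
    under [RHS]eq_bigr do rewrite mulrzDr mulrzA.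
    rewrite big_split /= -mulrz_suml; congr (_ + _).
    rewrite big_ord_recl /= mulr0z add0r; apply: eq_bigr => i _.
    rewrite raddfMz; congr (_ *~ Posz (d _)); apply: val_inj.
    by rewrite /= inordK// add0n ltnS ltnW.
  by rewrite d'E.
pose d k := projT1 (cid (fin k)).
have [i [j [ij dij]]] := pigeonhole_nat d.
have xij : x = iter (j - i) f x.
  apply: (injk i); rewrite -iterD subnKC 1?ltnW//.
  by rewrite (projT2 (cid (fin i))) (projT2 (cid (fin j))) -/(d i) -/(d j) dij.
have xl l : x = iter (l * (j - i)) f x.
  by elim: l => // l IH; rewrite mulSn iterD -IH.
move=> k; exists (iter (k * (j - i) - k) f x).
by rewrite -iterD subnKC -?xl// leq_pmulr// subn_gt0.
Qed.

(** * Modules over polynomial rings *)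

Section PolynomialAction.
Variables (P : idomainType) (M : lmodType P) (e : {linear M -> M}).
Implicit Types (p q : {poly P}) (m : M).

Definition poly_act (p : {poly P}) (m : M) := \sum_(i < size p) p`_i *: iter i e m.

Lemma poly_act_wide N p m : (size p <= N)%N ->
  poly_act p m = \sum_(i < N) p`_i *: iter i e m.
Proof.
move=> pN; rewrite /poly_act (big_ord_widen _ (fun i => p`_i *: iter i e m) pN) big_mkcond.
by apply: eq_bigr => i _; case: ltnP => // /(nth_default 0)->; rewrite scale0r.
Qed.

Lemma iter_linear k : linear (iter k e).
Proof. by elim: k => // k IH a x y; rewrite !iterS IH linearP. Qed.

Lemma poly_actDl p q m : poly_act (p + q) m = poly_act p m + poly_act q m.
Proof.
rewrite (@poly_act_wide (maxn (size p) (size q))) ?size_polyD//.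
rewrite (poly_act_wide _ (leq_maxl (size p) (size q))).
rewrite (poly_act_wide _ (leq_maxr (size p) (size q))) -big_split.
by apply: eq_bigr => i _; rewrite coefD scalerDl.
Qed.

Lemma poly_act_linear p : linear (poly_act p).
Proof.
move=> a x y; rewrite /poly_act scaler_sumr -big_split; apply: eq_bigr => i _.
by rewrite iter_linear scalerDr !scalerA mulrC.
Qed.

HB.instance Definition _ p := GRing.isLinear.Build P M M _ (poly_act p) (poly_act_linear p).

Lemma poly_actC c m : poly_act c%:P m = c *: m.
Proof. by rewrite (@poly_act_wide 1) ?size_polyC_leq1// big_ord1 coefC. Qed.

Lemma poly_act_mulX p m : poly_act (p * 'X) m = e (poly_act p m).
Proof.
rewrite (@poly_act_wide (size p).+1); last first.
  by rewrite (leq_trans (size_polyMleq _ _))// size_polyX addn2.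
rewrite big_ord_recl coefMX scale0r add0r linear_sum; apply: eq_bigr => i _.
by rewrite coefMX /= linearZ.
Qed.

Lemma poly_actCM c q m : poly_act (c%:P * q) m = c *: poly_act q m.
Proof.
rewrite (@poly_act_wide (size q)); last by rewrite mul_polyC size_scale_leq.
by rewrite scaler_sumr; apply: eq_bigr => i _; rewrite coefCM scalerA.
Qed.

Lemma poly_actM p q m : poly_act (p * q) m = poly_act p (poly_act q m).
Proof.
elim/poly_ind: p => [|p c IH]; first by rewrite mul0r !poly_actC !scale0r.
rewrite mulrDl !poly_actDl -mulrA ['X * q]mulrC mulrA !poly_act_mulX IH.
by rewrite poly_actCM poly_actC.
Qed.

(** [M] as a module over [{poly P}], the indeterminate acting as [e]. *)
Definition poly_module of {linear M -> M} : Type := M.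
HB.instance Definition _ := GRing.Zmodule.on (poly_module e).

Lemma poly_actX m : poly_act 'X m = e m.
Proof. by rewrite -['X]mul1r poly_act_mulX poly_actC scale1r. Qed.

Lemma poly_act1 m : poly_act 1 m = m. Proof. by rewrite poly_actC scale1r. Qed.

HB.instance Definition _ := GRing.Zmodule_isLmodule.Build {poly P} (poly_module e)
  (fun p q m => esym (poly_actM p q m)) poly_act1
  (fun p x y => raddfD (poly_act p) x y) (fun m p q => poly_actDl p q m).

Lemma poly_act_comm (g : M -> M) p m : linear g -> (forall x, g (e x) = e (g x)) ->
  g (poly_act p m) = poly_act p (g m).
Proof.
move=> glin ge; pose G : {linear M -> M} := HB.pack g (GRing.isLinear.Build P M M _ g glin).
have gi k x : g (iter k e x) = iter k e (g x) by elim: k => // k IH; rewrite !iterS ge IH.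
rewrite /poly_act -[g _]/(G _) linear_sum; apply: eq_bigr => i _.
by rewrite linearZ /= gi.
Qed.

End PolynomialAction.

(** * Spans with denominators *)

Section Span.
Variables (P : idomainType) (M : lmodType P) (C : P -> Prop).
Hypotheses (C1 : C 1) (CM : forall a b, C a -> C b -> C (a * b)).
Implicit Types (I : finType) (m : M).

Definition lspan I (w : I -> M) m := exists c : I -> P, m = \sum_i c i *: w i.
(** [C] is the set of admissible denominators: the nonzero scalars give the span
    over the fraction field, the units give the ordinary span. *)
Definition rspan I (w : I -> M) m := exists2 c, C c & lspan w (c *: m).

Lemma lspanP I (w : I -> M) a x y : lspan w x -> lspan w y -> lspan w (a *: x + y).
Proof.
move=> [c ->] [d ->]; exists (fun i => a * c i + d i).
rewrite scaler_sumr -big_split; apply: eq_bigr => i _.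
by rewrite scalerA scalerDl.
Qed.

Lemma lspan0 I (w : I -> M) : lspan w 0.
Proof. by exists (fun=> 0); rewrite big1// => i _; rewrite scale0r. Qed.

Lemma lspanZ I (w : I -> M) a x : lspan w x -> lspan w (a *: x).
Proof. by move=> wx; rewrite -[_ *: _]addr0; apply: lspanP => //; apply: lspan0. Qed.

Lemma rspanP I (w : I -> M) a x y : rspan w x -> rspan w y -> rspan w (a *: x + y).
Proof.
move=> [c Cc cx] [d Cd dy]; exists (c * d); first exact: CM.
have -> : (c * d) *: (a *: x + y) = (d * a) *: (c *: x) + c *: (d *: y).
  by rewrite scalerDr !scalerA -mulrA [c * (d * a)]mulrC.
by apply: lspanP => //; apply: lspanZ.
Qed.

Lemma lspan_rspan I (w : I -> M) x : lspan w x -> rspan w x.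
Proof. by exists 1 => //; rewrite scale1r. Qed.

Lemma rspan0 I (w : I -> M) : rspan w 0. Proof. exact/lspan_rspan/lspan0. Qed.

Lemma rspan_mem I (w : I -> M) i : rspan w (w i).
Proof.
apply: lspan_rspan; exists (fun j => (j == i)%:R).
by rewrite (bigD1 i)//= eqxx scale1r big1 ?addr0// => j /negPf->; rewrite scale0r.
Qed.

Lemma rspan_sat I (w : I -> M) c x : C c -> rspan w (c *: x) -> rspan w x.
Proof. by move=> Cc [d Cd dx]; exists (d * c); [exact: CM|rewrite -scalerA]. Qed.

Lemma rspan_sum I (w : I -> M) (J : finType) (c : J -> P) (x : J -> M) :
  (forall j, rspan w (x j)) -> rspan w (\sum_j c j *: x j).
Proof.
move=> wx; elim/big_rec: _ => [|j y _ wy]; first exact: rspan0.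
exact: rspanP.
Qed.

Lemma rspan_map I (J : finType) (w : I -> M) (w' : J -> M) (g : {linear M -> M}) m :
  (forall i, rspan w' (g (w i))) -> rspan w m -> rspan w' (g m).
Proof.
move=> gw [c Cc [a cm]]; apply: (rspan_sat Cc).
rewrite -linearZ_LR cm linear_sum; under eq_bigr do rewrite linearZ_LR.
exact: rspan_sum.
Qed.

(** A polynomial killing [e] makes the vectors [e ^ j (w i)], with [j] below its
    degree, span an [e]-stable module: the leading coefficient is the denominator
    needed for stability under [e], the constant one for its inverse. *)
Section Adjoin.
Variables (e ei : {linear M -> M}) (p : {poly P}) (I : finType) (w : I -> M).
Hypotheses (eK : cancel e ei) (p_lead : C (lead_coef p)) (p_0 : C p`_0).
Hypothesis p_kills : forall m, poly_act e p m = 0.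

Let d := (size p).-1.
Let w' (ji : 'I_d * I) : M := iter ji.1 e (w ji.2).

Let p_kills_wide m : \sum_(i < d.+1) p`_i *: iter i e m = 0.
Proof. by rewrite -[RHS](p_kills m); apply: esym; apply: poly_act_wide; exact: leqSpred. Qed.

Lemma adjoin_mem i : rspan w' (w i).
Proof.
case: (posnP d) => [d0|d_gt0].
  have wi0 : p`_0 *: w i = 0 by have := p_kills_wide (w i); rewrite d0 big_ord1.
  by apply: (rspan_sat p_0); rewrite wi0; apply: rspan0.
exact: (rspan_mem w' (Ordinal d_gt0, i)).
Qed.

Lemma adjoin_closed m : rspan w' m -> rspan w' (e m).
Proof.
apply: rspan_map => -[j i]; rewrite /w' /= -iterS.
have := ltn_ord j; rewrite leq_eqVlt => /predU1P[jd|jd]; last first.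
  exact: (rspan_mem w' (Ordinal jd, i)).
rewrite [j.+1]jd; apply: (rspan_sat p_lead); have /eqP := p_kills_wide (w i).
rewrite big_ord_recr /= addrC addr_eq0 => /eqP; rewrite /lead_coef -/d => ->.
rewrite -sumrN; under eq_bigr do rewrite -scaleNr.
by apply: rspan_sum => k; apply: (rspan_mem w' (k, i)).
Qed.

Lemma adjoin_closedV m : rspan w' m -> rspan w' (ei m).
Proof.
move=> wm; apply: (rspan_sat p_0); have /(congr1 ei)/eqP := p_kills_wide m.
rewrite big_ord_recl /= raddf0 raddfD /= linearZ /= addr_eq0 => /eqP->.
rewrite linear_sum -sumrN; under eq_bigr do rewrite linearZ /= -scaleNr eK.
by apply: rspan_sum => k; elim: {k}(val k) => //= k; apply: adjoin_closed.
Qed.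

Lemma adjoin_closed_comm (g : {linear M -> M}) : (forall m, g (e m) = e (g m)) ->
  (forall m, rspan w m -> rspan w (g m)) -> forall m, rspan w' m -> rspan w' (g m).
Proof.
move=> ge wg m; apply: rspan_map => -[j i]; rewrite /w' /=.
have -> : g (iter j e (w i)) = iter j e (g (w i)).
  by elim: (val j) => //= k <-.
have [c Cc [a cgw]] := wg _ (rspan_mem w i).
elim: (val j) => /= [|k IH]; last exact: adjoin_closed.
apply: (rspan_sat Cc); rewrite cgw; apply: rspan_sum => l; exact: adjoin_mem.
Qed.

End Adjoin.
End Span.

Definition is_action n (M : zmodType) (alpha : 'rV[int]_n -> M -> M) :=
  (forall m, alpha 0 m = m) /\ (forall u v m, alpha (u + v) m = alpha u (alpha v m)).

(** [g] generates [M] as a module over the group ring of Z^n with coefficients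
    in [P]. *)
Definition generates n (P : idomainType) (M : lmodType P) (alpha : 'rV[int]_n -> M -> M)
   (g : seq M) :=
  forall H : M -> Prop, H 0 -> (forall a x y, H x -> H y -> H (a *: x + y)) ->
    (forall u x, H x -> H (alpha u x)) -> (forall x, x \in g -> H x) -> forall x, H x.

Section FiniteSpan.
Variables (P : idomainType) (M : lmodType P) (C : P -> Prop) (n : nat).
Variables (alpha : 'rV[int]_n -> {linear M -> M}) (g : seq M).
Hypotheses (C1 : C 1) (CM : forall a b, C a -> C b -> C (a * b)).
Hypotheses (alphaP : is_action alpha) (gen : generates alpha g).
Let e (i : 'I_n) := alpha (delta_mx 0 i).

Lemma action_stable (H : M -> Prop) :
  (forall i x, H x -> H (e i x) /\ H (alpha (- delta_mx 0 i) x)) ->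
  forall u x, H x -> H (alpha u x).
Proof.
move=> He u x Hx; rewrite [u]row_sum_delta.
elim/big_rec: _ => [|i v _ IH]; first by rewrite alphaP.1.
rewrite alphaP.2; case: (u 0 i) => k.
  elim: k => [|k IHk]; first by rewrite scale0r alphaP.1.
  by rewrite intS scalerDl scale1r alphaP.2; apply (He _ _ IHk).1.
rewrite NegzE; elim: k.+1 => [|l IHl]; first by rewrite oppr0 scale0r alphaP.1.
by rewrite intS opprD scalerDl scaleN1r alphaP.2; apply (He _ _ IHl).2.
Qed.

(** Adjoining the generators of Z^n one at a time, each by the finitely many
    powers that its equation allows. *)
Lemma finite_span :
  (forall i, exists p, [/\ C (lead_coef p), C p`_0 & forall m, poly_act (e i) p m = 0]) ->
  exists (I : finType) (w : I -> M), forall m, rspan C w m.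
Proof.
move=> alg.
have comm u v x : alpha u (alpha v x) = alpha v (alpha u x).
  by rewrite -!alphaP.2 addrC.
have ok (s : seq 'I_n) : exists (I : finType) (w : I -> M),
    (forall x, x \in g -> rspan C w x) /\ forall i, i \in s -> forall x, rspan C w x ->
      rspan C w (e i x) /\ rspan C w (alpha (- delta_mx 0 i) x).
  elim: s => [|i s [I [w [wg ws]]]].
    exists 'I_(size g), (fun i : 'I_(size g) => g`_i); split=> // x /(nthP 0)[k kg <-].
    exact: (rspan_mem C1 (fun i : 'I_(size g) => g`_i) (Ordinal kg)).
  have [p [pl p0 pk]] := alg i.
  have eK : cancel (e i) (alpha (- delta_mx 0 i)).
    by move=> x; rewrite -alphaP.2 addNr alphaP.1.
  pose w' (ji : 'I_(size p).-1 * I) := iter ji.1 (e i) (w ji.2).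
  exists _, w'; split=> [x /wg|j].
    rewrite -[x in rspan _ w' x]/(idfun x); apply: rspan_map => // k.
    exact: adjoin_mem.
  rewrite inE => /predU1P[->|js] x wx.
    by split; [exact: (adjoin_closed C1 CM pl pk wx)|exact: (adjoin_closedV C1 CM eK pl p0 pk wx)].
  split; apply: (adjoin_closed_comm C1 CM pl p0 pk _ _ wx) => m; first exact: comm.
  - by move=> wm; exact: (ws j js m wm).1.
  - exact: comm.
  - by move=> wm; exact: (ws j js m wm).2.
have [I [w [wg ws]]] := ok (enum 'I_n); exists I, w; apply: gen => //.
- exact: rspan0.
- by move=> a x y; apply: rspanP.
- by apply: action_stable => i x; apply: ws; rewrite mem_enum.
Qed.
End FiniteSpan.

(** * Determinants over an integral domain acting on a module *)

Definition independent (P : idomainType) (M : lmodType P) s (b : 'I_s -> M) :=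
  forall c : 'I_s -> P, \sum_i c i *: b i = 0 -> forall i, c i = 0.

Definition rationally_spans (P : idomainType) (M : lmodType P) (I : finType) (b : I -> M) :=
  forall m, rspan (fun c : P => c != 0) b m.

(** Over the fraction field a dependent family can be shortened; denominators
    stay nonzero since [P] is a domain. *)
Lemma rational_basis (P : idomainType) (M : lmodType P) (I : finType) (w : I -> M) :
  rationally_spans w -> exists s (b : 'I_s -> M), rationally_spans b /\ independent b.
Proof.
move=> wspan; have : rationally_spans (fun i : 'I_#|I| => w (enum_val i)).
  move=> m; have [c c0 [a cm]] := wspan m; exists c => //; exists (fun i => a (enum_val i)).
  by rewrite cm (reindex (@enum_val I I))//; apply: onW_bij; exact: enum_val_bij.
move: #|I| (fun i => w (enum_val i)) => s {wspan}.
elim: s => [|s IHs] b bspan; first by exists 0%N, b; split=> // c _ [].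
have [ind|/existsNP[c /not_implyP[cb /existsNP[i0 /eqP ci0]]]] := pselect (independent b).
  by exists s.+1, b.
apply: (IHs (fun i => b (lift i0 i))) => m; have [d d0 [a dm]] := bspan m.
exists (c i0 * d); first by rewrite mulf_neq0.
exists (fun i => c i0 * a (lift i0 i) - a i0 * c (lift i0 i)).
move: cb; rewrite (bigD1_ord i0)//= => /eqP; rewrite addr_eq0 => /eqP cb.
rewrite -scalerA dm (bigD1_ord i0)//= scalerDr scalerA mulrC -scalerA cb scalerN.
under [RHS]eq_bigr do rewrite scalerBl.
rewrite [RHS]sumrB addrC !scaler_sumr; congr (_ - _); apply: eq_bigr => i _; exact: scalerA.
Qed.

Section Determinant.
Variables (P : idomainType) (M : lmodType P) (s : nat) (b : 'I_s -> M).
Hypotheses (bspan : rationally_spans b) (bind : independent b).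

Definition comb (x : 'rV[P]_s) := \sum_j x 0 j *: b j.

(** [B / c] is the matrix, in the basis [b] and acting on row vectors, of the map
    that [f] induces on the extension of [M] to the fraction field; neither that
    field nor that extension has to be constructed. *)
Definition represents (f : M -> M) (c : P) (B : 'M[P]_s) :=
  c != 0 /\ forall i, c *: f (b i) = comb (row i B).

Lemma comb_linear : linear comb.
Proof.
move=> a x y; rewrite /comb scaler_sumr -big_split; apply: eq_bigr => i _.
by rewrite !mxE scalerDl scalerA.
Qed.
HB.instance Definition _ := GRing.isLinear.Build P _ _ _ comb comb_linear.

Lemma comb_inj : injective comb.
Proof.
move=> x y /eqP; rewrite -subr_eq0 -linearB => /eqP/bind xy.
by apply/rowP => i; have := xy i; rewrite !mxE => /eqP; rewrite subr_eq0 => /eqP.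
Qed.

Lemma represents_comb (f : {linear M -> M}) c B x :
  represents f c B -> c *: f (comb x) = comb (x *m B).
Proof.
move=> [_ fB]; rewrite mulmx_sum_row (linear_sum comb) {1}/comb (linear_sum f) scaler_sumr.
apply: eq_bigr => i _.
by rewrite (linearZ_LR f) (linearZ_LR comb) /= -fB !scalerA mulrC.
Qed.

Lemma represents_ex (f : M -> M) : exists c B, represents f c B.
Proof.
have /boolp.choice[c cP] : forall i, exists c : P, c != 0 /\ lspan b (c *: f (b i)).
  by move=> i; have [c c0 h] := bspan (f (b i)); exists c.
have /boolp.choice[a aP] : forall i, exists a : 'I_s -> P, c i *: f (b i) = \sum_j a j *: b j.
  by move=> i; have [_ [a ->]] := cP i; exists a.
exists (\prod_i c i), (\matrix_(i, j) (\prod_(k | k != i) c k * a i j)); split.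
  by apply/prodf_neq0 => i _; apply: (cP i).1.
move=> i; rewrite (bigD1 i)//= mulrC -scalerA aP scaler_sumr.
by apply: eq_bigr => j _; rewrite !mxE scalerA.
Qed.

Lemma represents_unique f c B d D : represents f c B -> represents f d D -> d *: B = c *: D.
Proof.
move=> [c0 fB] [d0 fD]; apply/row_matrixP => i; apply: comb_inj.
by rewrite !(linearZ_LR (row i)) !(linearZ_LR comb) /= -fB -fD !scalerA mulrC.
Qed.

Lemma represents_comp (f : {linear M -> M}) g c B d D :
  represents f c B -> represents g d D -> represents (f \o g) (d * c) (D *m B).
Proof.
move=> fB [d0 gD]; split=> [|i]; first by rewrite mulf_neq0 ?fB.1.
by rewrite /= row_mul -(represents_comb _ fB) -gD (linearZ_LR f) !scalerA mulrC.
Qed.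

Lemma represents_scale l : represents ( *:%R l) 1 l%:M.
Proof.
split=> [|i]; first exact: oner_neq0.
rewrite scale1r /comb (bigD1 i)//= !mxE eqxx mulr1n big1 ?addr0// => j ji.
by rewrite !mxE eq_sym (negPf ji) scale0r.
Qed.

Lemma represents_det (f : {linear M -> M}) g c B :
  cancel g f -> represents f c B -> \det B != 0.
Proof.
move=> gK fB; have [d [D gD]] := represents_ex g.
have fg := represents_comp fB gD.
have id1 : represents (f \o g) 1 1%:M.
  split=> [|i]; first exact: oner_neq0.
  by rewrite -(represents_scale 1).2 /= gK !scale1r.
have /(congr1 determinant)/eqP := represents_unique fg id1.
rewrite !detZ det1 det_mulmx expr1n mulr1 mul1r; apply: contraTneq => ->.
by rewrite mulr0 eq_sym expf_neq0 ?fg.1.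
Qed.

Variable v : P -> nat.
Hypothesis vM : forall a c, a != 0 -> c != 0 -> v (a * c) = (v a + v c)%N.

Lemma valuationX a k : a != 0 -> v (a ^+ k) = (k * v a)%N.
Proof.
move=> a0; elim: k => [|k IH]; last by rewrite exprS vM ?expf_neq0// IH mulSn.
have /eqP := vM (oner_neq0 P) (oner_neq0 P).
by rewrite mulr1 -[X in X == _]addn0 eqn_add2l expr0 => /eqP <-.
Qed.

(** [h f] is the valuation of the determinant of [f] over the fraction field.
    It depends on [f] alone by [represents_unique], and is additive by
    [represents_comp]. *)
Lemma det_valuation : exists h : (M -> M) -> int,
  (forall f c B, represents f c B -> \det B != 0 ->
     h f = (v (\det B))%:Z - (s * v c)%:Z).
Proof.
suff /boolp.choice[h hP] : forall f, exists z : int, forall c B, represents f c B ->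
    \det B != 0 -> z = (v (\det B))%:Z - (s * v c)%:Z by exists h.
move=> f; have [c [B fB]] := represents_ex f.
have [B0|B0] := eqVneq (\det B) 0.
  exists 0 => d D fD D0; have /(congr1 determinant)/eqP := represents_unique fB fD.
  by rewrite !detZ B0 mulr0 eq_sym mulf_eq0 (negPf D0) orbF expf_eq0 (negPf fB.1) andbF.
exists ((v (\det B))%:Z - (s * v c)%:Z) => d D fD D0.
have /(congr1 determinant)/(congr1 v) := represents_unique fB fD.
rewrite !detZ !vM ?expf_neq0 ?fB.1 ?fD.1// !valuationX ?fB.1 ?fD.1//.
by move: (v (\det B)) (v (\det D)) (s * v c)%N (s * v d)%N => x y z t e; lia.
Qed.

End Determinant.

Lemma additive_row (n : nat) (h : 'rV[int]_n -> int) :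
  (forall u w, h (u + w) = h u + h w) ->
  forall u, h u = (u *m \col_i h (delta_mx 0 i)) 0 0.
Proof.
move=> hD; have h0 : h 0 = 0 by apply: (addrI (h 0)); rewrite -hD !addr0.
pose hA : {additive _ -> int} := HB.pack h (GRing.isNmodMorphism.Build _ _ h (conj h0 hD)).
move=> u; rewrite {1}[u]row_sum_delta -[h _]/(hA _) raddf_sum mxE; apply: eq_bigr => i _.
by rewrite -[u 0 i]intz scaler_int raddfMz !mxE !intz mulrzz mulrC.
Qed.

(** * Algebraicity of the action *)

(** Models a module [M] over the group ring of Z^n with a semilinear bijection
    [psi], that is [psi (u m) = (u F) (psi m)]: then [beta k] is the action
    conjugated by the [k]-th power of [psi]. Unlike [psi], all the [beta k u]
    commute with [beta 0], so that they survive the passage to polynomial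
    coefficients. *)
Record shift_system n (F : 'M[int]_n) (P : idomainType) (M : lmodType P)
    (beta : nat -> 'rV[int]_n -> {linear M -> M}) (g : seq M) : Prop := {
  shift_action : forall k, is_action (beta k);
  shift_step : forall k u m, beta k.+1 (u *m F) m = beta k u m;
  shift_gen : generates (beta 0%N) g }.

Definition algebraic (P : idomainType) (M : lmodType P) (e : {linear M -> M}) :=
  exists2 p : {poly P}, p != 0 & forall m, poly_act e p m = 0.

Lemma shift_stepX n (F : 'M[int]_n) (P : idomainType) (M : lmodType P)
    (beta : nat -> 'rV[int]_n -> {linear M -> M}) g k u m :
  shift_system F beta g -> beta k (u *m F ^+ k) m = beta 0%N u m.
Proof.
move=> sys; elim: k => [|k IH]; first by rewrite expr0 mulmx1.
by rewrite [F ^+ _]exprSr -[F ^+ k * F]/(F ^+ k *m F) mulmxA (shift_step sys).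
Qed.

(** Both maps belong to the action [beta k], since [beta 0 v] is
    [beta k (v F ^ k)]. *)
Lemma shift_comm n (F : 'M[int]_n) (P : idomainType) (M : lmodType P)
    (beta : nat -> 'rV[int]_n -> {linear M -> M}) g k u v m :
  shift_system F beta g -> beta k u (beta 0%N v m) = beta 0%N v (beta k u m).
Proof.
move=> sys; rewrite -!(shift_stepX k v _ sys) -!(shift_action sys k).2.
by rewrite addrC.
Qed.

(** Factors ['X] of an annihilating polynomial can be cancelled, as [e] is
    injective. *)
Lemma algebraic_coef0 (P : idomainType) (M : lmodType P) (e : {linear M -> M}) :
  injective e -> algebraic e ->
  exists p : {poly P}, [/\ lead_coef p != 0, p`_0 != 0 & forall m, poly_act e p m = 0].
Proof.
move=> einj [p p0 pk]; have [N le] := ubnP (size p); elim: N => // N IH in p p0 pk le *.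
have [p00|p00] := eqVneq p`_0 0; last by exists p; rewrite lead_coef_eq0.
have /factor_theorem[q pq] : root p 0 by rewrite /root horner_coef0 p00.
rewrite subr0 in pq; have q0 : q != 0 by apply: contraNneq p0 => q0; rewrite pq q0 mul0r.
apply: (IH q) => //; last by rewrite pq size_mulX in le.
by move=> m; apply: einj; rewrite raddf0 -poly_act_mulX -pq.
Qed.

(** The elements killed by [c *: f _] form a submodule stable under the action,
    so it suffices to treat the finitely many generators. *)
Lemma uniform_annihilator n (P : idomainType) (M : lmodType P) (C : P -> Prop)
    (alpha : 'rV[int]_n -> {linear M -> M}) g (f : {linear M -> M}) :
  C 1 -> (forall a b, C a -> C b -> C (a * b)) -> generates alpha g ->
  (forall u x, f (alpha u x) = alpha u (f x)) ->
  (forall x, x \in g -> exists2 c, C c & c *: f x = 0) ->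
  exists2 c, C c & forall x : M, c *: f x = 0.
Proof.
move=> C1 CM gen fa kg; have [c Cc cg] : exists2 c, C c & forall x, x \in g -> c *: f x = 0.
  elim: g kg {gen} => [|y g IH] kg; first by exists 1.
  have [|c Cc cg] := IH; first by move=> x xg; apply: kg; rewrite inE xg orbT.
  have [|d Cd dy] := kg y; first by rewrite mem_head.
  exists (c * d) => [|x]; first exact: CM.
  rewrite inE => /predU1P[->|/cg cx]; first by rewrite -scalerA dy scaler0.
  by rewrite mulrC -scalerA cx scaler0.
exists c => //; apply: gen => //; first by rewrite raddf0 scaler0.
  move=> a x y cx cy; rewrite linearD (linearZ_LR f) scalerDr cy.
  by rewrite scalerA mulrC -scalerA cx scaler0 addr0.
by move=> u x cx; rewrite fa -linearZ_LR cx raddf0.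
Qed.

Section Transcendence.
Variables (n : nat) (F : 'M[int]_n) (Fcap : contracting F).

(** The heart of the proof. Composing [beta k] with the valuation of the
    determinant gives functionals [f k] on Z^n with [f (k + 1) (u F) = f k u];
    they vanish by [divisible_functional_eq0]. But on the generator acting as the
    scalar [l] the value of [f 0] is [s * v l], which is positive. *)
Lemma no_valued_scalar (P : idomainType) (M : lmodType P)
    (beta : nat -> 'rV[int]_n -> {linear M -> M}) g s (b : 'I_s -> M)
    (v : P -> nat) (l : P) (i : 'I_n) :
  shift_system F beta g -> rationally_spans b -> independent b -> (0 < s)%N ->
  (forall a c, a != 0 -> c != 0 -> v (a * c) = (v a + v c)%N) ->
  (0 < v l)%N -> l != 0 -> (forall m, beta 0%N (delta_mx 0 i) m = l *: m) -> False.
Proof.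
move=> sys bspan bind s0 vM vl l0 il.
have [h hP] := det_valuation bspan bind vM.
have invN k u : cancel (beta k (- u)) (beta k u).
  by move=> m; rewrite -(shift_action sys k).2 addrN (shift_action sys k).1.
pose f k u := h (beta k u).
have fD k u w : f k (u + w) = f k u + f k w.
  have -> : f k (u + w) = h (beta k u \o beta k w).
    by congr h; apply/funext => m; rewrite (shift_action sys k).2.
  have [c [B uB]] := represents_ex bspan (beta k u).
  have [d [D wD]] := represents_ex bspan (beta k w).
  have B0 := represents_det bspan bind (invN k u) uB.
  have D0 := represents_det bspan bind (invN k w) wD.
  rewrite /f (hP _ _ _ uB B0) (hP _ _ _ wD D0) (hP _ _ _ (represents_comp uB wD)).
    rewrite det_mulmx !vM ?uB.1 ?wD.1// mulnDr.
    by move: (v (\det B)) (v (\det D)) (s * v c)%N (s * v d)%N => x y z t; lia.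
  by rewrite det_mulmx mulf_neq0.
have fF k u : f k.+1 (u *m F) = f k u.
  by congr h; apply/funext => m; rewrite (shift_step sys).
pose H k : 'cV[int]_n := \col_j f k (delta_mx 0 j).
have /(@divisible_functional_eq0 n F H Fcap) H0 : forall k, F *m H k.+1 = H k.
  move=> k; apply/colP => j; rewrite [RHS]mxE -fF.
  by rewrite (additive_row (fD k.+1)) -mulmxA -rowE [RHS]mxE.
have : f 0%N (delta_mx 0 i) = 0 by rewrite (additive_row (fD 0%N)) -/(H 0%N) H0 mulmx0 mxE.
rewrite /f (_ : (beta 0%N (delta_mx 0 i) : M -> M) = *:%R l); last exact/funext.
rewrite (hP _ _ _ (represents_scale b l)) det_scalar ?expf_neq0//.
rewrite (valuationX vM)// -{1}(expr0 l) (valuationX vM)// mul0n muln0 subr0.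
by case=> /eqP; rewrite muln_eq0 !eqn0Ngt s0 vl.
Qed.

Section PolynomialExtension.
Variables (P : idomainType) (M : lmodType P).
Variables (beta : nat -> 'rV[int]_n -> {linear M -> M}) (g : seq M) (j : 'I_n).
Hypothesis sys : shift_system F beta g.
Let e := beta 0%N (delta_mx 0 j).
Let M' : lmodType {poly P} := poly_module e.

Let beta_linear k u : linear (beta k u : M' -> M').
Proof.
move=> p x y; rewrite raddfD; congr (_ + _).
apply: (@poly_act_comm _ _ e (beta k u)) => [|m]; first exact: linearP.
exact: (shift_comm k u _ m sys).
Qed.

Definition poly_beta k u : {linear M' -> M'} :=
  HB.pack (beta k u : M' -> M') (GRing.isLinear.Build {poly P} M' M' _ _ (beta_linear k u)).

Lemma poly_scaleC (c : P) (m : M') : c%:P *: m = (c *: (m : M) : M').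
Proof. exact: (poly_actC e c m). Qed.

Lemma poly_shift_system : shift_system F poly_beta (g : seq M').
Proof.
split=> [k|k u m|H H0 HP Ha Hg]; first exact: (shift_action sys k).
  exact: (shift_step sys).
by apply: (shift_gen sys) => // a x y Hx Hy; rewrite -poly_scaleC; apply: HP.
Qed.

Lemma poly_algebraic k : algebraic (beta 0%N (delta_mx 0 k)) ->
  algebraic (poly_beta 0%N (delta_mx 0 k)).
Proof.
move=> [p p0 pk]; exists (map_poly polyC p).
  by rewrite map_poly_eq0_id0 ?polyC_eq0 ?lead_coef_eq0.
move=> m; rewrite -[RHS](pk m) (@poly_act_wide _ _ _ (size p)) ?size_poly//.
apply: eq_bigr => i _; rewrite coef_map_id0// poly_scaleC.
have it : iter i (poly_beta 0%N (delta_mx 0 k)) m = iter i (beta 0%N (delta_mx 0 k)) m :> M.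
  by elim: (val i) => //= l ->.
exact: (congr1 (fun x : M => p`_i *: x) it).
Qed.

(** It is a root of ['X - x], where [x], the indeterminate of [{poly P}], acts as
    this generator. *)
Lemma poly_algebraic_self : algebraic (poly_beta 0%N (delta_mx 0 j)).
Proof.
exists ('X - ('X)%:P); first by rewrite polyXsubC_eq0.
move=> m; rewrite -polyCN poly_actDl poly_actC poly_actX scaleNr.
apply/eqP; rewrite subr_eq0; apply/eqP; exact: (esym (poly_actX e m)).
Qed.

End PolynomialExtension.

(** If all generators are algebraic, [M] has a finite basis over the fraction
    field, which is empty by [no_valued_scalar]. Otherwise a possibly
    transcendental generator is turned into an indeterminate, the valuation being
    extended through the leading coefficient; that the extended system is torsion
    means that the generator was algebraic after all. *)
Lemma valued_torsion (s : seq 'I_n) (P : idomainType) (M : lmodType P)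
    (beta : nat -> 'rV[int]_n -> {linear M -> M}) (g : seq M)
    (v : P -> nat) (l : P) (i : 'I_n) :
  shift_system F beta g ->
  (forall j, j \notin s -> algebraic (beta 0%N (delta_mx 0 j))) ->
  (forall a c, a != 0 -> c != 0 -> v (a * c) = (v a + v c)%N) ->
  (0 < v l)%N -> l != 0 -> (forall m, beta 0%N (delta_mx 0 i) m = l *: m) ->
  exists2 c : P, c != 0 & forall m : M, c *: m = 0.
Proof.
elim: s P M beta g v l => [|j s IH] P M beta g v l sys alg vM vl l0 il.
  have [|i'|I [w wspan]] := finite_span (C := fun c : P => c != 0) (oner_neq0 P) _
    (shift_action sys 0%N) (shift_gen sys).
  - by move=> a b; apply: mulf_neq0.
  - apply: algebraic_coef0; last exact: alg.
    apply: (can_inj (g := beta 0%N (- delta_mx 0 i'))) => m.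
    by rewrite -(shift_action sys 0%N).2 addNr (shift_action sys 0%N).1.
  have [[|t] [b [bspan bind]]] := rational_basis wspan; last first.
    by case: (no_valued_scalar sys bspan bind _ vM vl l0 il).
  apply: (uniform_annihilator (C := fun c : P => c != 0) (f := idfun) (oner_neq0 P) _
    (shift_gen sys)) => // [a c|x _]; first exact: mulf_neq0.
  by have [c c0 [a ca]] := bspan x; exists c; rewrite // ca big_ord0.
have sys' := poly_shift_system j sys.
apply: (IH _ _ _ _ v l sys) => // k ks; have [->|kj] := eqVneq k j; last first.
  by apply: alg; rewrite inE negb_or kj.
have [//|||||c c0 ck] := IH _ _ _ _ (fun p : {poly P} => v (lead_coef p)) l%:P sys'.
- move=> k' k's; have [->|kj] := eqVneq k' j; first exact: poly_algebraic_self.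
  by apply: poly_algebraic; apply: alg; rewrite inE negb_or kj.
- by move=> a c a0 c0; rewrite lead_coefM vM ?lead_coef_eq0.
- by rewrite lead_coefC.
- by rewrite polyC_eq0.
- by move=> m; rewrite poly_scaleC; apply: il.
by exists c.
Qed.

(** Were the generator transcendental, [M] would not be torsion over the
    polynomial ring in which it is the indeterminate, and the degree would be a
    valuation positive on it. *)
Theorem generators_algebraic (P : idomainType) (M : lmodType P)
    (beta : nat -> 'rV[int]_n -> {linear M -> M}) (g : seq M) (i : 'I_n) :
  shift_system F beta g -> algebraic (beta 0%N (delta_mx 0 i)).
Proof.
move=> sys; have sys' := poly_shift_system i sys.
have [|||||c c0 ck] := @valued_torsion (enum 'I_n) _ _ _ _
  (fun p : {poly P} => (size p).-1) 'X i sys'.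
- by move=> j; rewrite mem_enum.
- by move=> a c a0 c0; rewrite size_mul//; move: a0 c0; rewrite -!size_poly_gt0; lia.
- by rewrite size_polyX.
- by rewrite polyX_eq0.
- by move=> m; exact: (esym (poly_actX (beta 0%N (delta_mx 0 i)) m)).
by exists c.
Qed.

End Transcendence.

(** * Joint eigenvalues are roots of unity *)

Lemma row_int_ind n (H : 'rV[int]_n -> Prop) :
  H 0 -> (forall u w, H u -> H w -> H (u - w)) -> (forall i, H (delta_mx 0 i)) -> forall u, H u.
Proof.
move=> H0 HB Hd u; have HN w : H w -> H (- w) by move=> Hw; rewrite -sub0r; apply: HB.
have HD w x : H w -> H x -> H (w + x) by move=> Hw Hx; rewrite -[x]opprK; apply/HB/HN.
rewrite [u]row_sum_delta; elim/big_ind: _ => // i _.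
have Hn k : H (k%:Z *: delta_mx 0 i).
  by elim: k => [|k IH]; rewrite ?scale0r// intS scalerDl scale1r; apply: HD.
by case: (u 0 i) => k //; rewrite NegzE scaleNr; apply: HN.
Qed.

Section Eigenvalues.
Variables (n : nat) (F : 'M[int]_n) (Fcap : contracting F) (Fdet : \det F != 0).

Lemma mulmx_expr_inj k (x y : 'rV[int]_n) : x *m F ^+ k = y *m F ^+ k -> x = y.
Proof.
have Finj (z : 'rV[int]_n) : z *m F = 0 -> z = 0.
  move=> zF; apply/eqP/negPn/negP => z0; case/negP: Fdet; apply/det0P; by exists z.
move=> /eqP; rewrite -subr_eq0 -mulmxBl => xy; apply/eqP; rewrite -subr_eq0; apply/eqP.
move: xy => /eqP; elim: k => [|k IH]; first by rewrite expr0 mulmx1.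
by rewrite [F ^+ _]exprSr -[_ * F]/(_ *m F) mulmxA => /Finj/IH.
Qed.

Lemma det_sub_expr i j : (i < j)%N -> \det (F ^+ i - F ^+ j) != 0.
Proof.
move=> ij; apply/negP => /det0P[x x0]; rewrite mulmxBr => /eqP.
rewrite subr_eq0 -(subnK (ltnW ij)) exprD -[_ * _]/(_ *m _) mulmxA => /eqP/mulmx_expr_inj xF.
case/eqP: x0; apply: Fcap => k; exists (x *m F ^+ (k * (j - i) - k)).
rewrite -mulmxA -[_ *m F ^+ k]/(_ * _) -exprD subnK; last by rewrite leq_pmulr// subn_gt0.
elim: k => [|k IH]; first by rewrite mul0n expr0 mulmx1.
by rewrite mulSn exprD -[_ * _]/(_ *m _) mulmxA -xF.
Qed.

Variables (s : nat) (rho : 'rV[int]_n -> 'M[algC]_s) (T T' : 'M[algC]_s).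
Hypotheses (rho0 : rho 0 = 1%:M) (rhoD : forall u w, rho (u + w) = rho u *m rho w).
Hypotheses (TT' : T *m T' = 1%:M) (T'T : T' *m T = 1%:M).
Hypothesis rhoT : forall u, rho u *m T = T *m rho (u *m F).

Let rhoV u : rho (- u) *m rho u = 1%:M. Proof. by rewrite -rhoD addNr. Qed.
Let rhoC u w : comm_mx (rho u) (rho w). Proof. by rewrite /comm_mx -!rhoD addrC. Qed.
Let rhoT' u : T' *m rho u = rho (u *m F) *m T'.
Proof. by rewrite -[LHS]mulmx1 -TT' -!mulmxA (mulmxA (rho u)) rhoT !mulmxA T'T mul1mx. Qed.

(** The eigenspace is stable under the commuting family, which has a common
    eigenvector in it. *)
Lemma joint_eigenvector u a : eigenvalue (rho u) a ->
  exists v : 'rV_s, [/\ v != 0, v *m rho u = a *: v &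
     exists chi : 'rV[int]_n -> algC, forall w, v *m rho w = chi w *: v].
Proof.
move=> ea; pose W := eigenspace (rho u) a.
have stW w : stablemx W (rho w) by apply: comm_mx_stable_eigenspace; apply: rhoC.
have [|A B /mapP[i _ ->] /mapP[j _ ->]|v v0 /allP vs] :=
  @common_eigenvector algC (\rank W) [seq restrictmx W (rho (delta_mx 0 i)) | i <- enum 'I_n].
- by rewrite lt0n mxrank_eq0.
- by rewrite /comm_mx -!conjmxM ?inE ?stablemx_row_base ?stW// rhoC.
pose x := v *m row_base W; have x0 : x != 0 by rewrite mulmx_free_eq0 ?row_base_free.
exists x; split=> //; first by apply/eigenspaceP; rewrite mulmx_sub ?eq_row_base.
suff /boolp.choice[chi chiP] : forall w, exists c, x *m rho w = c *: x by exists chi.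
apply: row_int_ind => [|w w' [c xc] [d xd]|i].
- by exists 1; rewrite rho0 mulmx1 scale1r.
- have d0 : d != 0.
    apply: contraNneq x0 => d0; rewrite d0 scale0r in xd.
    by rewrite -[x]mulmx1 -(rhoV (- w')) opprK mulmxA xd mul0mx.
  exists (c / d); rewrite rhoD mulmxA xc -scalemxAl -scalerA; congr (_ *: _).
  apply: (scalerI d0); rewrite scalemxAl -xd -mulmxA -rhoD addrN rho0 mulmx1.
  by rewrite scalerA divff ?scale1r.
- have : stablemx v (restrictmx W (rho (delta_mx 0 i))).
    by apply: vs; apply/mapP; exists i; rewrite ?mem_enum.
  by rewrite stablemx_restrict// => /sub_rVP[c xc]; exists c.
Qed.

(** A joint eigenvalue is a character [chi] of Z^n; by [rhoT] the inverse [T']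
    takes its eigenvectors to eigenvectors of [chi (_ *m F)]. There are finitely many of
    them, so [chi] takes equal values on [u F ^ i] and [u F ^ j] for some [i < j];
    as [F ^ i - F ^ j] has finite cokernel, [chi] has finite order. *)
Lemma eigenvalue_root_of_unity u a : eigenvalue (rho u) a -> exists2 N, (0 < N)%N & a ^+ N = 1.
Proof.
move=> /joint_eigenvector[v [v0 va [chi vchi]]].
have chiE w c : v *m rho w = c *: v -> chi w = c.
  move=> vc; have := vchi w; rewrite vc => /eqP; rewrite -subr_eq0 -scalerBl.
  by rewrite scaler_eq0 (negPf v0) orbF subr_eq0 => /eqP.
have chi0 : chi 0 = 1 by apply: chiE; rewrite rho0 mulmx1 scale1r.
have chiD w w' : chi (w + w') = chi w * chi w'.
  by apply: chiE; rewrite rhoD mulmxA vchi -scalemxAl vchi scalerA.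
have chiV w : chi (- w) = (chi w)^-1.
  have /eqP := chi0; rewrite -(addNr w) chiD => /eqP e.
  have w0 : chi w != 0 by apply/eqP => w0; move/eqP: e; rewrite w0 mulr0 eq_sym oner_eq0.
  by apply: (mulIf w0); rewrite e mulVf.
(* [vk k] is a joint eigenvector with eigenvalue [chi (_ *m F ^+ k)]. *)
pose vk k := v *m T' ^+ k.
have T'S k : T' ^+ k.+1 = T' ^+ k *m T' := exprSr T' k.
have vk0 k : vk k != 0.
  elim: k => [|k IH]; first by rewrite /vk expr0 mulmx1.
  have vkS : vk k.+1 = vk k *m T' by rewrite /vk T'S mulmxA.
  by apply: contraNneq IH => vk0; rewrite -[vk k]mulmx1 -T'T mulmxA -vkS vk0 mul0mx.
have vkP k w : vk k *m rho w = chi (w *m F ^+ k) *: vk k.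
  elim: k w => [|k IH] w; first by rewrite /vk !expr0 !mulmx1.
  rewrite /vk T'S mulmxA -mulmxA rhoT' mulmxA IH [F ^+ k.+1]exprS -[F * _]/(F *m _) mulmxA.
  by rewrite -scalemxAl.
(* The characters [chi (_ *m F ^+ k)] take values on the basis vectors in [S]. *)
pose S := flatten
  [seq sval (closed_field_poly_normal (char_poly (rho (delta_mx 0 i)))) | i <- enum 'I_n].
have chiS k (i : 'I_n) : chi (delta_mx 0 i *m F ^+ k) \in S.
  apply/flatten_mapP; exists i; first by rewrite mem_enum.
  have : eigenvalue (rho (delta_mx 0 i)) (chi (delta_mx 0 i *m F ^+ k)).
    by apply/eigenvalueP; exists (vk k).
  rewrite eigenvalue_root_char; case: closed_field_poly_normal => r /= ->.
  by rewrite (monicP (char_poly_monic _)) scale1r root_prod_XsubC.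
have idx k (i : 'I_n) : (index (chi (delta_mx 0 i *m F ^+ k)%R) S < size S)%N by rewrite index_mem.
pose d k : {ffun 'I_n -> 'I_(size S)} := [ffun i : 'I_n => Ordinal (idx k i)].
have [i [j [ij dij]]] := pigeonhole_nat d.
have chi1 w : chi (w *m (F ^+ i - F ^+ j)) = 1.
  elim/row_int_ind: w => [|w w' cw cw'|t]; first by rewrite mul0mx.
    by rewrite mulmxBl chiD chiV cw cw' invr1 mulr1.
  have /(congr1 (fun f : {ffun 'I_n -> 'I_(size S)} => val (f t))) := dij; rewrite !ffunE /= => e.
  have /(congr1 (nth 0 S)) := e; rewrite !nth_index ?chiS// => e'.
  rewrite mulmxBr chiD chiV e' mulfV//; apply/eqP => c0.
  have /eqP := chi0; rewrite -(addrN (delta_mx 0 t *m F ^+ j)) chiD c0 mul0r.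
  by rewrite eq_sym oner_eq0.
pose D := \det (F ^+ i - F ^+ j); have D0 : D != 0 by apply: det_sub_expr.
have chiX w k : chi (w *+ k) = chi w ^+ k.
  by elim: k => [|k IH]; rewrite ?mulr0n ?expr0// mulrS chiD IH exprS.
exists (absz D); first by rewrite lt0n absz_eq0.
rewrite -(chiE _ _ va) -chiX.
have chiDu : chi (u *~ D) = 1.
  rewrite -scaler_int intz -mul_mx_scalar -(mul_adj_mx (F ^+ i - F ^+ j)) mulmxA; exact: chi1.
move: chiDu; case: (D) => k; first by [].
by rewrite NegzE mulrNz chiV => /(congr1 GRing.inv); rewrite invrK invr1.
Qed.

End Eigenvalues.

(** * Integral equations from characteristic polynomials *)

(** If such a polynomial kills an invertible operator, then the operator and its
    inverse are both integral over Z. *)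
Definition bi_unit (q : {poly int}) := (lead_coef q \is a GRing.unit) && (q`_0 \is a GRing.unit).

Lemma bi_unitM p q : bi_unit p -> bi_unit q -> bi_unit (p * q).
Proof.
move=> /andP[pl p0] /andP[ql q0]; apply/andP; split; first by rewrite lead_coefM unitrM pl.
by rewrite coefM big_ord1 subnn unitrM p0.
Qed.

Lemma bi_unit1 : bi_unit 1.
Proof. by rewrite /bi_unit lead_coef1 coef1 unitr1. Qed.

Lemma bi_unit_Xn_sub1 N : (0 < N)%N -> bi_unit ('X^N - 1).
Proof.
move=> N0; rewrite /bi_unit lead_coefXnsubC// unitr1 coefB coefXn coef1.
by rewrite eq_sym eqn0Ngt N0 sub0r unitrN unitr1.
Qed.

(** Each factor ['X - a] divides ['X^N - 1] with [a ^ N = 1]. *)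
Lemma char_poly_dvd_bi_unit s (A : 'M[algC]_s) :
  (forall a, eigenvalue A a -> exists2 N, (0 < N)%N & a ^+ N = 1) ->
  exists2 q, bi_unit q & char_poly A %| map_poly intr q.
Proof.
move=> Aroot; have [r rA] := closed_field_poly_normal (char_poly A).
rewrite (monicP (char_poly_monic _)) scale1r in rA; rewrite rA.
have {Aroot} : forall a, a \in r -> exists2 N, (0 < N)%N & a ^+ N = 1.
  by move=> a ar; apply: Aroot; rewrite eigenvalue_root_char rA root_prod_XsubC.
elim: r {rA} => [|a r IH] rroot.
  by exists 1; [exact: bi_unit1 | rewrite big_nil dvd1p].
have [|q qb qd] := IH; first by move=> b br; apply: rroot; rewrite inE br orbT.
have [|N N0 aN] := rroot a; first by rewrite mem_head.
exists (('X^N - 1) * q); first by apply: bi_unitM => //; apply: bi_unit_Xn_sub1.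
rewrite big_cons rmorphM dvdp_mul// rmorphB rmorph1 /= map_polyXn dvdp_XsubCl.
by rewrite /root !hornerE aN subrr.
Qed.

Section Representation.
Variables (M : lmodType int) (s : nat) (b : 'I_s -> M).
Hypotheses (bspan : rationally_spans b) (bind : independent b).

(** The matrices [B / c] over the algebraic numbers, where eigenvalues exist. *)
Lemma algC_representation : exists R : (M -> M) -> 'M[algC]_s, forall f c B,
  represents b f c B -> R f = (c%:~R)^-1 *: map_mx intr B.
Proof.
suff /boolp.choice[R RP] : forall f, exists X : 'M[algC]_s, forall c B, represents b f c B ->
    X = (c%:~R)^-1 *: map_mx intr B by exists R.
move=> f.
have [c [B fB]] := represents_ex bspan f.
exists ((c%:~R)^-1 *: map_mx intr B) => d D fD.
have /(congr1 (map_mx (intr : int -> algC))) := represents_unique bind fB fD.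
rewrite !map_mxZ => e.
have c0 : c%:~R != 0 :> algC by rewrite intr_eq0 fB.1.
have d0 : d%:~R != 0 :> algC by rewrite intr_eq0 fD.1.
apply: (scalerI c0); apply: (scalerI d0).
rewrite [c%:~R *: (_^-1 *: _)]scalerA mulfV// scale1r e.
by rewrite !scalerA mulrAC mulfV// mul1r.
Qed.

Variable R : (M -> M) -> 'M[algC]_s.
Hypothesis RP : forall f c B, represents b f c B -> R f = (c%:~R)^-1 *: map_mx intr B.

Lemma rep_comp (f : {linear M -> M}) g : R (f \o g) = R g *m R f.
Proof.
have [c [B fB]] := represents_ex bspan f.
have [d [D gD]] := represents_ex bspan g.
rewrite (RP (represents_comp fB gD)) (RP fB) (RP gD) -scalemxAl -scalemxAr scalerA.
by rewrite map_mxM rmorphM invfM.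
Qed.

Lemma rep_scale l : R ( *:%R l) = l%:~R%:M.
Proof. by rewrite (RP (represents_scale b l)) invr1 scale1r map_scalar_mx. Qed.

Lemma rep_id f : f =1 id -> R f = 1%:M.
Proof.
move=> fid; have -> : f = *:%R 1 by apply/funext => m; rewrite fid scale1r.
by rewrite rep_scale.
Qed.

Lemma rep_add f g : R (fun m => f m + g m) = R f + R g.
Proof.
have [c [B fB]] := represents_ex bspan f.
have [d [D gD]] := represents_ex bspan g.
have c0 : c%:~R != 0 :> algC by rewrite intr_eq0 fB.1.
have d0 : d%:~R != 0 :> algC by rewrite intr_eq0 gD.1.
have fg : represents b (fun m => f m + g m) (c * d) (d *: B + c *: D).
  split=> [|i]; first by rewrite mulf_neq0 ?fB.1 ?gD.1.
  rewrite scalerDr mulrC -scalerA fB.2 mulrC -scalerA gD.2.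
  rewrite -!(linearZ_LR (comb b)) -(linearD (comb b)) /=; congr comb.
  by rewrite !linearD !linearZ.
rewrite (RP fg) (RP fB) (RP gD) map_mxD !map_mxZ scalerDr !scalerA rmorphM invfM.
by rewrite mulfVK// mulrAC mulVf// mul1r.
Qed.

(** The zero matrix only sees [M] up to torsion. *)
Lemma rep_eq0 f : linear f -> R f = 0 -> forall m, exists2 c : int, c != 0 & c *: f m = 0.
Proof.
move=> flin; pose f' : {linear M -> M} := HB.pack f (GRing.isLinear.Build _ _ _ _ f flin).
have [c [B fB]] := represents_ex bspan f'.
rewrite (RP fB) => /eqP; rewrite scaler_eq0 invr_eq0 intr_eq0 (negPf fB.1) /= => /eqP B0.
have {}B0 : B = 0.
  apply/matrixP => i j; move/matrixP: B0 => /(_ i j); rewrite !mxE => /eqP.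
  by rewrite intr_eq0 => /eqP.
move=> m; have [d d0 [a dm]] := bspan m; exists (c * d); first by rewrite mulf_neq0 ?fB.1.
rewrite -scalerA -[f m]/(f' m) -(linearZ_LR f') dm (linear_sum f') scaler_sumr.
apply: big1 => i _; rewrite (linearZ_LR f') scalerA mulrC -scalerA fB.2 B0 row0.
by rewrite (linear0 (comb b)) scaler0.
Qed.

End Representation.

Lemma rep_poly_act (M : lmodType int) s (b : 'I_s -> M) (R : (M -> M) -> 'M[algC]_s)
    (e : {linear M -> M}) (q : {poly int}) :
  rationally_spans b ->
  (forall f c B, represents b f c B -> R f = (c%:~R)^-1 *: map_mx intr B) ->
  char_poly (R e) %| map_poly intr q -> R (poly_act e q) = 0.
Proof.
case: s b R => [|t] b R bspan RP.
  by move=> _; apply/matrixP => -[].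
have -> : R (poly_act e q) = horner_mx (R e) (map_poly intr q).
  elim/poly_ind: q => [|q c IH].
    have -> : poly_act e 0 = *:%R 0 by apply/funext => m; rewrite -(poly_actC e).
    by rewrite (rep_scale RP) map_poly0 rmorph0 raddf0.
  have -> : poly_act e (q * 'X + c%:P) = (fun m => (e \o poly_act e q) m + *:%R c m).
    by apply/funext => m; rewrite poly_actDl poly_act_mulX poly_actC.
  rewrite (rep_add bspan RP) (rep_comp bspan RP) (rep_scale RP) IH.
  rewrite rmorphD rmorphM /= map_polyX map_polyC /=.
  by rewrite rmorphD rmorphM /= horner_mx_X horner_mx_C.
by move=> /dvdpP[r ->]; rewrite rmorphM /= Cayley_Hamilton mulr0.
Qed.

(** * Finite generation over the integers *)

Definition additive_generates n (M : zmodType) (alpha : 'rV[int]_n -> M -> M) (g : seq M) :=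
  forall H : M -> Prop, H 0 -> (forall x y, H x -> H y -> H (x - y)) ->
    (forall u x, H x -> H (alpha u x)) -> (forall x, x \in g -> H x) -> forall x, H x.

Record additive_shift n (F : 'M[int]_n) (M : zmodType)
    (beta : nat -> 'rV[int]_n -> {additive M -> M}) (g : seq M) : Prop := {
  add_shift_action : forall k, is_action (beta k);
  add_shift_step : forall k u m, beta k.+1 (u *m F) m = beta k u m;
  add_shift_gen : additive_generates (beta 0%N) g }.

Section Integers.
Variables (n : nat) (F : 'M[int]_n) (M : zmodType).
Variables (beta : nat -> 'rV[int]_n -> {additive M -> M}) (g : seq M).
Hypothesis sys : additive_shift F beta g.

Lemma int_linear (f : {additive M -> M}) : linear (f : zmodule M -> zmodule M).
Proof. by move=> a x y; rewrite raddfD /= !scalezrE raddfMz. Qed.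

Definition int_fun (f : {additive M -> M}) : {linear zmodule M -> zmodule M} :=
  HB.pack (f : zmodule M -> zmodule M)
    (GRing.isLinear.Build int (zmodule M) (zmodule M) _ _ (int_linear f)).

Definition int_beta k u := int_fun (beta k u).

Lemma int_shift_system : shift_system F int_beta (g : seq (zmodule M)).
Proof.
split; [exact: (add_shift_action sys)|exact: (add_shift_step sys)|].
move=> H H0 HP Ha Hg; apply: (add_shift_gen sys) => // x y Hx Hy.
have := HP (-1) y x Hy Hx; by rewrite scaleN1r addrC.
Qed.
End Integers.

Section ModPrime.
Local Open Scope quotient_scope.
Variables (p : nat) (pr : prime p) (M : zmodType).

Definition multiples : {pred M} := [pred m | `[< exists x, m = x *+ p >]].
Lemma multiplesP m : reflect (exists x, m = x *+ p) (m \in multiples).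
Proof. exact: asboolP. Qed.

Lemma multiples_closed : zmod_closed multiples.
Proof.
split=> [|x y /multiplesP[a ->] /multiplesP[b ->]]; apply/multiplesP.
  by exists 0; rewrite mul0rn.
by exists (a - b); rewrite mulrnBl.
Qed.
HB.instance Definition _ := GRing.isZmodClosed.Build M multiples multiples_closed.

(** Carries the proof that [p] is prime so that its module structure over ['F_p]
    can refer to it. *)
Definition mod_prime of prime p : Type := Quotient.quot multiples.
Local Notation Q := (mod_prime pr).
HB.instance Definition _ := GRing.Zmodule.on Q.

Definition mod_proj (m : M) : Q := \pi_(Quotient.quot multiples) m.

Lemma mod_projD : {morph mod_proj : x y / x + y}.
Proof. by move=> x y; rewrite /mod_proj piE. Qed.

Lemma mod_proj0 : mod_proj 0 = 0.
Proof. by apply: (addrI (mod_proj 0)); rewrite -mod_projD !addr0. Qed.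

HB.instance Definition _ := GRing.isNmodMorphism.Build M Q mod_proj (conj mod_proj0 mod_projD).

Lemma mod_proj_eq x y : mod_proj x = mod_proj y <-> exists z, x - y = z *+ p.
Proof.
split=> [/eqP|xy]; first by rewrite /mod_proj -Quotient.idealrBE => /multiplesP.
by apply/eqP; rewrite /mod_proj -Quotient.idealrBE; apply/multiplesP.
Qed.

Lemma mod_proj_surj (x : Q) : exists m, x = mod_proj m.
Proof. by exists (repr x); rewrite /mod_proj reprK. Qed.

Lemma mod_prime_mulrn (x : Q) : x *+ p = 0.
Proof.
have [m ->] := mod_proj_surj x; rewrite -raddfMn -(raddf0 mod_proj).
by apply/mod_proj_eq; exists m; rewrite subr0.
Qed.

Lemma mod_prime_modn (x : Q) k : x *+ (k %% p) = x *+ k.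
Proof. by rewrite [in RHS](divn_eq k p) mulrnDr mulnC mulrnA mod_prime_mulrn mul0rn add0r. Qed.

Definition Fp_scale (a : 'F_p) (x : Q) : Q := x *+ a.

Lemma Fp_scaleA a b x : Fp_scale a (Fp_scale b x) = Fp_scale (a * b) x.
Proof.
rewrite /Fp_scale -mulrnA -(mod_prime_modn x (b * a)) mulnC.
by congr (_ *+ _); congr (_ %% _)%N; rewrite Fp_cast.
Qed.
Lemma Fp_scale1 x : Fp_scale 1 x = x.
Proof.
rewrite /Fp_scale -[RHS]mulr1n -(mod_prime_modn x 1).
by congr (_ *+ _); congr (_ %% _)%N; rewrite Fp_cast.
Qed.
Lemma Fp_scaleDr a : {morph Fp_scale a : x y / x + y}.
Proof. by move=> x y; rewrite /Fp_scale mulrnDl. Qed.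
Lemma Fp_scaleDl x : {morph Fp_scale^~ x : a b / a + b}.
Proof.
move=> a b; rewrite /Fp_scale -mulrnDr -(mod_prime_modn x (a + b)).
by congr (_ *+ _); congr (_ %% _)%N; rewrite Fp_cast.
Qed.
HB.instance Definition _ := GRing.Zmodule_isLmodule.Build 'F_p Q
  Fp_scaleA Fp_scale1 Fp_scaleDr Fp_scaleDl.

Section Induced.
Variable f : {additive M -> M}.

Definition mod_fun0 (x : Q) : Q := mod_proj (f (repr (x : Quotient.quot multiples))).

Lemma mod_fun0E m : mod_fun0 (mod_proj m) = mod_proj (f m).
Proof.
apply/mod_proj_eq; rewrite -raddfB.
have [|z ->] := (mod_proj_eq (repr (mod_proj m : Quotient.quot multiples)) m).1.
  by rewrite /mod_proj reprK.
by exists (f z); rewrite raddfMn.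
Qed.

Lemma mod_fun_linear : linear mod_fun0.
Proof.
move=> a x y; have [[m ->] [m' ->]] := (mod_proj_surj x, mod_proj_surj y).
rewrite -[a *: _]/(mod_proj m *+ a) -[a *: _]/(_ *+ a) -raddfMn -raddfD !mod_fun0E.
by rewrite raddfD raddfMn !raddfD raddfMn.
Qed.
HB.instance Definition _ := GRing.isLinear.Build 'F_p Q Q _ mod_fun0 mod_fun_linear.
Definition mod_fun : {linear Q -> Q} := mod_fun0.
Lemma mod_funE m : mod_fun (mod_proj m) = mod_proj (f m).
Proof. exact: mod_fun0E. Qed.
End Induced.

Lemma mod_shift_system n (F : 'M[int]_n) (beta : nat -> 'rV[int]_n -> {additive M -> M}) g :
  additive_shift F beta g ->
  shift_system F (fun k u => mod_fun (beta k u)) [seq mod_proj m | m <- g].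
Proof.
move=> sys; split=> [k|k u x|H H0 HP Ha Hg x].
- split=> [x|u w x]; have [m ->] := mod_proj_surj x; rewrite !(mod_funE _ m).
    by rewrite (add_shift_action sys k).1.
  by rewrite (add_shift_action sys k).2 mod_funE.
- by have [m ->] := mod_proj_surj x; rewrite !mod_funE (add_shift_step sys).
- have [m ->] := mod_proj_surj x; apply: (add_shift_gen sys (H := fun m => H (mod_proj m))).
  + by rewrite mod_proj0.
  + by move=> y z Hy Hz; rewrite raddfB addrC -scaleN1r; apply: HP.
  + by move=> u y Hy; rewrite -mod_funE; apply: Ha.
  + by move=> y yg; apply: Hg; apply: map_f.
Qed.

End ModPrime.

(** The class of ['X] modulo [q] is a unit of a finite ring. *)
Lemma dvdp_Xn_sub1 (p : nat) (q : {poly 'F_p}) : q`_0 != 0 ->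
  exists2 N, (0 < N)%N & q %| 'X^N - 1.
Proof.
move=> q0; have qn0 : q != 0 by apply: contraNneq q0 => ->; rewrite coef0.
pose d k : {ffun 'I_(size q) -> 'F_p} := [ffun i : 'I_(size q) => ('X^k %% q)`_i].
have [i [j [ij dij]]] := pigeonhole_nat d.
exists (j - i)%N; first by rewrite subn_gt0.
have eqm : 'X^i %% q = 'X^j %% q.
  apply/polyP => k; have [kq|kq] := ltnP k (size q).
    by have /ffunP/(_ (Ordinal kq)) := dij; rewrite !ffunE.
  by rewrite !nth_default// (leq_trans _ kq)// ltnW// ltn_modp.
have : q %| 'X^i * ('X^(j - i) - 1).
  by rewrite mulrBr mulr1 -exprD subnKC 1?ltnW// /dvdp modpD modpN eqm subrr.
rewrite Gauss_dvdpr// coprimep_expr// coprimepX.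
by rewrite /root horner_coef0.
Qed.

Section FiniteGeneration.
Variables (n : nat) (F : 'M[int]_n) (Fcap : contracting F) (Fdet : \det F != 0).
Variables (M : zmodType) (alpha : 'rV[int]_n -> {additive M -> M}) (g : seq M).
Variables (psi psi' : {additive M -> M}).
Hypotheses (psiK : cancel psi psi') (psi'K : cancel psi' psi).
Hypotheses (alphaP : is_action alpha) (gen : additive_generates alpha g).
Hypothesis psi_alpha : forall u m, psi (alpha u m) = alpha (u *m F) (psi m).

Let beta_fun k u m := iter k psi' (alpha u (iter k psi m)).

Let iterD k (f : {additive M -> M}) : {morph iter k f : x y / x + y}.
Proof. by elim: k => // k IH x y; rewrite !iterS IH raddfD. Qed.

Let iter0 k (f : {additive M -> M}) : iter k f 0 = 0.
Proof. by elim: k => //= k ->; rewrite raddf0. Qed.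

Let beta_fun_additive k u : nmod_morphism (beta_fun k u).
Proof.
split=> [|x y]; rewrite /beta_fun; first by rewrite iter0 raddf0 iter0.
by rewrite iterD raddfD iterD.
Qed.

Let beta k u : {additive M -> M} :=
  HB.pack (beta_fun k u) (GRing.isNmodMorphism.Build M M _ (beta_fun_additive k u)).

Let iterK k : cancel (iter k psi) (iter k psi').
Proof. by elim: k => // k IH x; rewrite iterSr iterS psiK IH. Qed.
Let iterK' k : cancel (iter k psi') (iter k psi).
Proof. by elim: k => // k IH x; rewrite iterSr iterS psi'K IH. Qed.

Lemma conjugate_shift : additive_shift F beta g.
Proof.
split=> [k|k u m|//].
  split=> [m|u w m]; rewrite /= /beta_fun; first by rewrite alphaP.1 iterK.
  by rewrite iterK' alphaP.2.
by rewrite /= /beta_fun iterSr iterS -psi_alpha psiK.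
Qed.

Let e i := int_fun (alpha (delta_mx 0 i)).

(** In characteristic 0: on [M] extended to the algebraic numbers, which is
    finite-dimensional, the eigenvalues of the action are roots of unity. *)
Lemma torsion_bi_unit (i : 'I_n) : exists q (c : int), [/\ bi_unit q, c != 0 &
  forall m, c *: poly_act (e i) q m = 0].
Proof.
have sys := int_shift_system conjugate_shift.
have [|j|I [w wspan]] := finite_span (C := fun c : int => c != 0) (oner_neq0 _) _
   (shift_action sys 0%N) (shift_gen sys).
- by move=> a b; apply: mulf_neq0.
- apply: algebraic_coef0; last exact: (generators_algebraic Fcap j sys).
  apply: (can_inj (g := int_beta beta 0%N (- delta_mx 0 j))) => m.
  by rewrite -(shift_action sys 0%N).2 addNr (shift_action sys 0%N).1.
have [s [b [bspan bind]]] := rational_basis wspan.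
have [R RP] := algC_representation bspan bind.
pose rho u := R (int_fun (alpha u)).
have rho0 : rho 0 = 1%:M by apply: (rep_id RP) => m; apply: alphaP.1.
have alphaC u t m : alpha u (alpha t m) = alpha t (alpha u m) by rewrite -!alphaP.2 addrC.
have rhoD u t : rho (u + t) = rho u *m rho t.
  rewrite -(rep_comp bspan RP); congr R; apply/funext => m /=.
  by rewrite alphaP.2 alphaC.
have TT' : R (int_fun psi') *m R (int_fun psi) = 1%:M.
  by rewrite -(rep_comp bspan RP) (rep_id RP)//; apply: psi'K.
have T'T : R (int_fun psi) *m R (int_fun psi') = 1%:M.
  by rewrite -(rep_comp bspan RP) (rep_id RP)//; apply: psiK.
have rhoT u : rho u *m R (int_fun psi) = R (int_fun psi) *m rho (u *m F).
  rewrite -!(rep_comp bspan RP); congr R; apply/funext => m /=; exact: psi_alpha.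
have [q qb qd] := char_poly_dvd_bi_unit
  (@eigenvalue_root_of_unity _ _ Fcap Fdet _ _ _ _ rho0 rhoD T'T TT' rhoT (delta_mx 0 i)).
have lin := poly_act_linear (e i) q.
have Rq0 := rep_poly_act bspan RP qd.
pose f : {linear zmodule M -> zmodule M} := poly_act (e i) q.
have [|u x|x _|c c0 cq] := @uniform_annihilator n _ _ (fun c => c != 0) (int_beta beta 0%N) g f
   (oner_neq0 _) _ (shift_gen sys).
- by move=> a d; apply: mulf_neq0.
- apply: esym; apply: (@poly_act_comm _ _ (e i) (int_beta beta 0%N u)) => [|m].
    exact: int_linear.
  exact: alphaC.
- exact: (rep_eq0 bspan RP lin Rq0 x).
by exists q, c.
Qed.

(** In characteristic [p]: an algebraic invertible operator over ['F_p] has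
    finite order. *)
Lemma mod_prime_bi_unit (i : 'I_n) p : prime p -> exists2 q, bi_unit q &
  forall m, exists m' : zmodule M, poly_act (e i) q m = p%:Z *: m'.
Proof.
move=> pr; have sys := mod_shift_system pr conjugate_shift.
have [|q [_ q0 qk]] := algebraic_coef0 _ (generators_algebraic Fcap i sys).
  apply: (can_inj (g := mod_fun pr (beta 0%N (- delta_mx 0 i)))) => m.
  by rewrite -(shift_action sys 0%N).2 addNr (shift_action sys 0%N).1.
have [N N0 /dvdpP[r rq]] := dvdp_Xn_sub1 q0.
exists ('X^N - 1) => [|m]; first exact: bi_unit_Xn_sub1.
pose ei := mod_fun pr (beta 0%N (delta_mx 0 i)).
have : poly_act ei ('X^N - 1) (mod_proj pr (m : M)) = 0.
  by rewrite rq poly_actM qk raddf0.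
have actXn (P : idomainType) (L : lmodType P) (f : {linear L -> L}) x k :
    poly_act f ('X^k - 1) x = iter k f x - x.
  rewrite -['X^k]mul1r -(polyC1 P) -polyCN poly_actDl poly_actC scaleN1r; congr (_ - _).
  elim: k => [|k IH]; first by rewrite expr0 mulr1 poly_actC scale1r.
  by rewrite exprSr mulrA poly_act_mulX IH.
have iterE k : iter k ei (mod_proj pr (m : M)) =
    mod_proj pr (iter k (alpha (delta_mx 0 i)) (m : M)).
  by elim: k => // k IH; rewrite !iterS IH mod_funE.
rewrite actXn iterE => /eqP; rewrite subr_eq0 => /eqP/mod_proj_eq[m' mm'].
by exists m'; rewrite actXn; exact: mm'.
Qed.

Lemma mod_bi_unit (i : 'I_n) c : (0 < c)%N -> exists2 q, bi_unit q &
  forall m, exists m' : zmodule M, poly_act (e i) q m = c%:Z *: m'.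
Proof.
have [k] := ubnP c; elim: k c => // k IH c; rewrite ltnS => ck c0.
have [c1|c1] := leqP c 1.
  exists 1; first exact: bi_unit1.
  by move=> m; exists m; rewrite (_ : c = 1%N) ?scale1r ?poly_act1//; lia.
have pr := pdiv_prime c1; have cE := divnK (pdiv_dvd c).
have [||q qb qm] := IH (c %/ pdiv c)%N.
- by apply: leq_trans ck; rewrite ltn_Pdiv// prime_gt1.
- by rewrite divn_gt0 ?pdiv_gt0// pdiv_leq.
have [r rb rm] := mod_prime_bi_unit i pr.
exists (r * q) => [|m]; first exact: bi_unitM.
have [m' mm'] := qm m; have [m'' mm''] := rm m'; exists m''.
rewrite poly_actM mm' (linearZ_LR (poly_act (e i) r)) /= mm'' scalerA; congr (_ *: _).
by rewrite -PoszM cE.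
Qed.

(** The equation valid up to [c]-torsion and the one valid modulo [c] multiply
    to an equation valid on [M], with unit leading and constant coefficients. *)
Theorem finitely_generated_of_shift : exists (I : finType) (w : I -> M), forall m, int_span w m.
Proof.
have sys := int_shift_system conjugate_shift.
have [|j|I [w wspan]] := finite_span (C := fun c : int => c \is a GRing.unit) (unitr1 _) _
   (shift_action sys 0%N) (shift_gen sys).
- by move=> a b ua ub; rewrite unitrM ua ub.
- have [q [c [qb c0 qc]]] := torsion_bi_unit j.
  have [|r rb rm] := @mod_bi_unit j (absz c); first by rewrite lt0n absz_eq0.
  have /andP[ul u0] := bi_unitM qb rb; exists (q * r); split=> // m.
  rewrite [LHS](_ : _ = poly_act (e j) (q * r) m)//.
  have [m' mm'] := rm m; rewrite poly_actM mm' (linearZ_LR (poly_act (e j) q)).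
  have [->|->] : (absz c)%:Z = c \/ (absz c)%:Z = - c by lia.
    exact: qc.
  by rewrite /= scaleNr qc oppr0.
exists I, w => m; have [c uc [a am]] := wspan m.
exists (fun i => c^-1 * a i); rewrite -[m in LHS](scale1r (m : zmodule M)) -(mulVr uc) -scalerA am.
by rewrite scaler_sumr; apply: eq_bigr => i _; rewrite scalerA.
Qed.
End FiniteGeneration.

(** * The class map onto Z^n *)

Definition additive_of (A : groupType) of abelian_group A : Type := A.
Section AdditiveOf.
Variables (A : groupType) (abA : abelian_group A).
HB.instance Definition _ := Choice.on (additive_of abA).
HB.instance Definition _ := GRing.isZmodule.Build (additive_of abA)
  (@mulgA A) abA (@mul1g A) (@mulVg A).
End AdditiveOf.

Lemma finitely_generated_ind (G : groupType) : finitely_generated G ->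
  exists s : seq G, forall H : G -> Prop, H 1%g -> (forall x y, H x -> H y -> H (x / y)%g) ->
    (forall x, x \in s -> H x) -> forall x, H x.
Proof.
move=> [s sgen]; exists s => H H1 HV Hs x.
apply: ((gen_subgroupP _ _).1 (sgen x) H) => [|y /= ys]; last exact: Hs.
split=> [|y z /set_mem Hy /set_mem Hz]; apply/mem_set; first exact: H1.
exact: HV.
Qed.

Section QuotientMap.
Local Open Scope quotient_scope.
Variables (G : groupType) (N : groupClosed G) (nN : normal_subgroup N).
Hypothesis abA : abelian_group (quotient_group nN).
Local Notation A := (quotient_group nN).
Local Notation U := (additive_of abA).

Definition cls (x : G) : U := \pi_A x.

Lemma clsM x y : cls (x * y)%g = cls x + cls y.
Proof. by rewrite /cls !piE. Qed.

Lemma cls_eq x y : cls x = cls y <-> (x^-1 * y)%g \in N.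
Proof. by rewrite -(quotient_eqE nN); split=> /eqP. Qed.

Lemma cls1 : cls 1%g = 0. Proof. by apply: (addrI (cls 1)%g); rewrite -clsM mulg1 addr0. Qed.
Lemma clsV x : cls (x^-1)%g = - cls x.
Proof. by apply: (addrI (cls x)); rewrite -clsM mulgV cls1 subrr. Qed.

Lemma cls_eq0 x : cls x = 0 <-> x \in N.
Proof. by rewrite -cls1 -gpredV -[(x^-1)%g]mulg1; apply: cls_eq. Qed.

Lemma cls_surj (u : U) : exists x, u = cls x.
Proof. by exists (repr (u : A)); rewrite /cls reprK. Qed.
End QuotientMap.

Section Setup.
Local Open Scope quotient_scope.
Variables (G : groupType) (phi : UMagmaMorphism.type G G).
Hypotheses (phi_inj : injective phi).
Local Notation S := (stable_image phi).

Lemma stable_imageP x : x \in S <-> forall k, exists y, x = iter k phi y.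
Proof.
split=> [/set_mem xS [|k]|xS]; first by exists x.
  by have [y _ <-] := xS k.+1 isT; exists y.
by apply/mem_set => k _; have [y ->] := xS k; exists y.
Qed.

Lemma iter_phiM k : {morph iter k phi : x y / (x * y)%g}.
Proof. by elim: k => // k IH x y; rewrite !iterS IH gmulfM. Qed.

Lemma stable_image_phi x : (phi x \in S) = (x \in S).
Proof.
apply/idP/idP => /stable_imageP xS; apply/stable_imageP => k.
  by have [y] := xS k.+1; rewrite iterS => /phi_inj ->; exists y.
by have [y ->] := xS k; exists (phi y); rewrite -iterSr.
Qed.

Lemma stable_image_onto x : x \in S -> exists2 y, y \in S & x = phi y.
Proof.
move=> xS; have [y xy] := (stable_imageP x).1 xS 1%N; exists y => //.
by rewrite -stable_image_phi; have <- : x = phi y := xy.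
Qed.

Hypotheses (G_fg : finitely_generated G) (nS : normal_subgroup S).
Hypothesis abA : abelian_group (quotient_group nS).
Local Notation A := (quotient_group nS).
Local Notation U := (additive_of abA).

Local Notation cls := (cls abA).

Definition induced (u : U) : U := cls (phi (repr (u : A))).

Lemma inducedE x : induced (cls x) = cls (phi x).
Proof.
apply/cls_eq; rewrite -gmulfV -gmulfM stable_image_phi; apply/cls_eq.
by rewrite /cls reprK.
Qed.

Lemma induced_additive : nmod_morphism induced.
Proof.
split=> [|u v]; first by rewrite -cls1 inducedE gmulf1 cls1.
have [[x ->] [y ->]] := (cls_surj u, cls_surj v).
by rewrite -clsM !inducedE gmulfM clsM.
Qed.
HB.instance Definition _ := GRing.isNmodMorphism.Build U U induced induced_additive.

Lemma induced_inj : injective induced.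
Proof.
move=> u v; have [[x ->] [y ->]] := (cls_surj u, cls_surj v).
by rewrite !inducedE => /cls_eq; rewrite -gmulfV -gmulfM stable_image_phi => /cls_eq.
Qed.

Lemma iter_inducedE k x : iter k induced (cls x) = cls (iter k phi x).
Proof. by elim: k => // k IH; rewrite !iterS IH inducedE. Qed.

(** An element of every iterated image modulo the stable image [S] is in every
    iterated image, because [S] is contained in each of them. *)
Lemma induced_cap (u : U) : (forall k, exists v, u = iter k induced v) -> u = 0.
Proof.
have [x ->] := cls_surj u => xk; apply/cls_eq0/stable_imageP => k.
have [v] := xk k; have [y ->] := cls_surj v; rewrite iter_inducedE => /esym/cls_eq yx.
have [z zyx] := (stable_imageP _).1 yx k; exists (y * z)%g.
by rewrite iter_phiM -zyx mulVKg.
Qed.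

(** The quotient by the stable image is Z^n because it is finitely generated
    and, by [torsion_free_of_shift], torsion-free; [F] is the matrix of the
    endomorphism induced by [phi]. *)
Lemma class_map_ex : exists n (c : G -> 'rV[int]_n) (F : 'M[int]_n),
  [/\ (forall x y, c (x * y)%g = c x + c y) /\ (forall x, c x = 0 <-> x \in S),
      (forall u, exists x, c x = u), (forall x, c (phi x) = c x *m F),
      contracting F & \det F != 0].
Proof.
have [s sgen] := finitely_generated_ind G_fg.
pose g (i : 'I_(size s)) := cls (nth 1%g s i).
have gen (x : U) : int_span g x.
  have [y ->] := cls_surj x; elim/sgen: y => [|y z gy gz|y /(nthP 1%g)[i si <-]].
  - by rewrite cls1; apply: int_span0.
  - by rewrite clsM clsV; apply: int_spanB.
  - exact: (int_span_mem g (Ordinal si)).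
have tf := torsion_free_of_shift gen induced_inj induced_cap.
have [n [e [espan eind]]] := torsion_free_basis gen tf.
have /boolp.choice[co coP] : forall u : U, exists a : 'rV[int]_n, u = \sum_i e i *~ a 0 i.
  by move=> u; have [a ->] := espan u; exists (\row_i a i); apply: eq_bigr => i _; rewrite mxE.
have co_eq u (a : 'rV_n) : u = \sum_i e i *~ a 0 i -> co u = a.
  rewrite {1}[u]coP => /eqP; rewrite -subr_eq0 -sumrB => /eqP ua; apply/rowP => i.
  apply/eqP; rewrite -subr_eq0; apply/eqP; apply: (eind (fun i => co u 0 i - a 0 i)).
  by rewrite -[RHS]ua; apply: eq_bigr => j _; rewrite mulrzBr.
have co_add : nmod_morphism co.
  split=> [|u v]; first by apply: co_eq; rewrite big1// => i _; rewrite mxE.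
  apply: co_eq; rewrite {1}[u]coP {1}[v]coP -big_split; apply: eq_bigr => i _.
  by rewrite mxE mulrzDr.
pose coA : {additive U -> 'rV[int]_n} := HB.pack co (GRing.isNmodMorphism.Build _ _ co co_add).
have co_inj u v : co u = co v -> u = v by move=> uv; rewrite [u]coP [v]coP uv.
pose c x := co (cls x); pose F : 'M[int]_n := \matrix_i co (induced (e i)).
have cF x : c (phi x) = c x *m F.
  rewrite /c -inducedE {1}[cls x]coP -[co _]/(coA _) !raddf_sum mulmx_sum_row.
  by apply: eq_bigr => i _; rewrite !raddfMz rowK -scaler_int intz.
have cFk k x : c (iter k phi x) = c x *m F ^+ k.
  elim: k => [|k IH]; first by rewrite expr0 mulmx1.
  by rewrite iterS cF IH [F ^+ k.+1]exprSr mulmxA.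
have cM x y : c (x * y)%g = c x + c y by rewrite /c clsM co_add.2.
have c0 x : c x = 0 <-> x \in S.
  rewrite -(cls_eq0 abA) /c; split=> [|->]; last by rewrite co_add.1.
  by rewrite -co_add.1 => /co_inj.
have c_surj u : exists x, c x = u.
  have [x xu] := cls_surj (\sum_i e i *~ u 0 i); exists x; exact/co_eq/esym.
exists n, c, F; split=> //.
- move=> u uF; have [z zu] := c_surj u; rewrite -zu; apply/c0/cls_eq0/induced_cap => k.
  have [y uy] := uF k; have [t ty] := c_surj y; exists (cls t); rewrite iter_inducedE.
  by apply: co_inj; rewrite -/(c z) -/(c _) zu cFk ty.
- apply/negP => /det0P[v /eqP v0 vF]; apply: v0; have [x xv] := c_surj v.
  by rewrite -xv; apply/c0; rewrite -stable_image_phi; apply/c0; rewrite cF xv.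
Qed.
End Setup.

(** * Consequences of the class map *)

Section ClassMap.
Local Open Scope quotient_scope.
Local Open Scope classical_set_scope.
Local Open Scope card_scope.
Variables (G : groupType) (phi : UMagmaMorphism.type G G).
Local Notation S := (stable_image phi).
Variables (nS : normal_subgroup S) (n : nat) (c : G -> 'rV[int]_n) (F : 'M[int]_n).
Hypotheses (phi_inj : injective phi).
Hypotheses (cM : forall x y, c (x * y)%g = c x + c y) (c0 : forall x, c x = 0 <-> x \in S).
Hypotheses (c_surj : forall u, exists x, c x = u) (cF : forall x, c (phi x) = c x *m F).
Hypothesis Fdet : \det F != 0.

Lemma class1 : c 1%g = 0. Proof. by apply: (addrI (c 1)%g); rewrite -cM mulg1 addr0. Qed.
Lemma classV x : c (x^-1)%g = - c x.
Proof. by apply: (addrI (c x)); rewrite -cM mulgV class1 subrr. Qed.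
Lemma class_eq x y : c x = c y <-> (x^-1 * y)%g \in S.
Proof.
rewrite -c0 cM classV addrC; split=> [->|/eqP]; first by rewrite subrr.
by rewrite subr_eq0 => /eqP.
Qed.

Lemma quotient_isomorphic : isomorphic (quotient_group nS) (free_abelian n).
Proof.
pose f (q : quotient_group nS) : free_abelian n := c (repr q).
have fE x : f (\pi_(quotient_group nS) x) = c x.
  by apply/class_eq; rewrite -(quotient_eqE nS) reprK.
have fD p q : f (p * q)%g = (f p : 'rV[int]_n) + f q.
  have -> : (p * q)%g = \pi_(quotient_group nS) (repr p * repr q)%g.
    by rewrite (pi_quotient_mulM nS) !reprK.
  by rewrite fE cM.
have f1 : f 1%g = 0 :> 'rV[int]_n.
  by apply: (addrI (f 1%g : 'rV[int]_n)); rewrite -fD mulg1 addr0.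
have fM : monoid.monoid_morphism f by split.
pose F0 : UMagmaMorphism.type (quotient_group nS) (free_abelian n) :=
  HB.pack f (isUMagmaMorphism.Build _ _ f fM).
exists F0.
have /boolp.choice[l lP] := c_surj.
exists (fun u => \pi_(quotient_group nS) (l u)) => [q|u]; last by rewrite /= fE lP.
by rewrite -[RHS]reprK; apply/eqP; rewrite quotient_eqE; apply/class_eq; rewrite lP.
Qed.

Lemma stable_image_range x : x \in S -> range phi x.
Proof. by move=> /stable_imageP/(_ 1%N)[y ->]; exists y. Qed.

(** If [n = 0] the stable image is everything, so [phi] is onto. *)
Lemma class_rank_gt0 : ~~ (left_cosets (range phi) #<= `I_1) -> (0 < n)%N.
Proof.
apply: contraNT; rewrite -eqn0Ngt => /eqP n0.
have xS x : x \in S by apply/c0; move: (c x); rewrite n0 => v; rewrite [v]thinmx0.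
have -> : `I_1 = [set 0%N] by apply/seteqP; split=> k /=; rewrite ltnS leqn0 => /eqP.
apply: (@card_le_trans _ _ _ [set [set: G]]);
  last by rewrite -(image_set1 (fun=> [set: G]) 0%N); exact: card_image_le.
apply: subset_card_le => _ [x _ <-] /=; apply/seteqP; split=> // y _.
by exists (x^-1 * y)%g; [exact: stable_image_range|rewrite mulVKg].
Qed.

Lemma class_range x : (exists v, c x = v *m F) -> range phi x.
Proof.
move=> [v xv]; have [y yv] := c_surj v.
have /class_eq/stable_image_range[z _ zE] : c (phi y) = c x by rewrite cF yv.
by exists (y * z)%g => //; rewrite gmulfM zE mulVKg.
Qed.

Lemma rangeM x y : range phi x -> range phi y -> range phi (x * y)%g.
Proof. by move=> [a _ <-] [b _ <-]; exists (a * b)%g; rewrite ?gmulfM. Qed.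
Lemma rangeV x : range phi x -> range phi (x^-1)%g.
Proof. by move=> [a _ <-]; exists (a^-1)%g; rewrite ?gmulfV. Qed.

(** Each class is congruent modulo [\det F], hence modulo the image of [F], to
    one with coordinates in a finite range, and an element whose class is in the
    image of [F] is in the image of [phi]. *)
Lemma finite_cosets : finite_set (left_cosets (range phi)).
Proof.
have /boolp.choice[l lP] := c_surj.
pose D := \det F; pose T := {ffun 'I_n -> 'I_(absz D)}.
pose rep (t : T) : G := l (\row_i (val (t i))%:Z).
apply: (@sub_finite_set _ _ [set [set (rep t * h)%g | h in range phi] | t in [set: T]]); last first.
  exact/finite_image/finite_finset.
move=> _ [x _ <-].
have lt (z : int) : (absz (z %% D)%Z < absz D)%N.
  by move: (modz_ge0 z Fdet) (ltz_mod z Fdet); rewrite -/D; move: (modz _ _) => t; lia.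
pose t : T := [ffun i : 'I_n => Ordinal (lt (c x 0 i))].
exists t => //.
have xt : range phi (x^-1 * rep t)%g.
  apply: class_range; exists (- (\row_i divz (c x 0 i) D) *m \adj F).
  rewrite -mulmxA mul_adj_mx mul_mx_scalar cM classV lP.
  apply/rowP => i; rewrite !mxE ffunE /= gez0_abs ?modz_ge0// -/D.
  rewrite {1}(divz_eq (c x 0 i) D); lia.
apply/seteqP; split=> _ [h hr <-].
  by exists (x^-1 * rep t * h)%g; [exact: rangeM|rewrite -mulgA mulVKg].
exists ((x^-1 * rep t)^-1 * h)%g; first exact/rangeM/hr/rangeV.
by rewrite invgM invgK -!mulgA mulVKg.
Qed.

End ClassMap.

(** * The abelianized stable image as a module *)

Section Abelianization.
Local Open Scope quotient_scope.
Variable G : groupType.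
Local Notation D := (@derived_subgroup G).
Local Notation Q := (quotient_group (@derived_subgroup_normal G)).

Lemma commutator_derived (x y : G) : [~ x, y]%g \in D.
Proof. by apply/gen_subgroupP => H _; apply; exists x => //; exists y. Qed.

Lemma abelianization_abelian : abelian_group (abelianization G).
Proof.
move=> p q; suff: (quotient_mul (\pi_Q (repr (p : Q))) (\pi_Q (repr (q : Q))) : Q) =
    quotient_mul (\pi_Q (repr (q : Q))) (\pi_Q (repr (p : Q))) by rewrite !reprK.
rewrite -!pi_quotient_mulM; apply/eqP.
rewrite quotient_eqE invgM -mulgA; exact: commutator_derived.
Qed.

Definition ab_module := additive_of abelianization_abelian.
HB.instance Definition _ := GRing.Zmodule.on ab_module.

Definition ab_proj (x : G) : ab_module := cls abelianization_abelian x.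

Lemma ab_projM x y : ab_proj (x * y)%g = ab_proj x + ab_proj y.
Proof. exact: clsM. Qed.

Lemma ab_proj_eq x y : ab_proj x = ab_proj y <-> (x^-1 * y)%g \in D.
Proof. exact: cls_eq. Qed.

Lemma ab_proj_surj (m : ab_module) : exists x, m = ab_proj x.
Proof. exact: cls_surj. Qed.

Lemma ab_proj1 : ab_proj 1%g = 0.
Proof. exact: cls1. Qed.

Lemma ab_projV x : ab_proj (x^-1)%g = - ab_proj x.
Proof. exact: clsV. Qed.

Section Functor.
Variables (h : G -> G) (hM : {morph h : x y / (x * y)%g}).

Definition ab_fun0 (m : ab_module) : ab_module := ab_proj (h (repr (m : Q))).

Lemma morph1 : h 1%g = 1%g.
Proof. by apply: (mulgI (h 1%g)); rewrite -hM !mulg1. Qed.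
Lemma morphV x : h (x^-1)%g = (h x)^-1%g.
Proof. by apply: (mulgI (h x)); rewrite -hM !mulgV morph1. Qed.

Lemma derived_morph x : x \in D -> h x \in D.
Proof.
move=> /gen_subgroupP xD; apply/gen_subgroupP => H [H1 HV] HC.
apply: (xD [set y | H (h y)]%classic) => [|_ [y _ [z _ <-]]] /=.
  split=> [|y z /set_mem /= Hy /set_mem /= Hz]; apply/mem_set => /=.
    by rewrite morph1; apply: set_mem.
  by rewrite hM morphV; apply: set_mem; apply: HV; apply: mem_set.
by apply/HC; exists (h y) => //; exists (h z); rewrite // /commg /conjg !hM !morphV.
Qed.

Lemma ab_fun0E x : ab_fun0 (ab_proj x) = ab_proj (h x).
Proof.
apply/ab_proj_eq; rewrite -morphV -hM; apply: derived_morph; apply/ab_proj_eq.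
by rewrite /ab_proj /cls reprK.
Qed.

Lemma ab_fun_additive : nmod_morphism ab_fun0.
Proof.
split=> [|p q]; first by rewrite -ab_proj1 ab_fun0E morph1.
have [[x ->] [y ->]] := (ab_proj_surj p, ab_proj_surj q).
by rewrite -ab_projM !ab_fun0E hM ab_projM.
Qed.
Definition ab_fun : {additive ab_module -> ab_module} :=
  HB.pack ab_fun0 (GRing.isNmodMorphism.Build _ _ ab_fun0 ab_fun_additive).
Lemma ab_funE x : ab_fun (ab_proj x) = ab_proj (h x).
Proof. exact: ab_fun0E. Qed.
End Functor.

Lemma finitely_generated_abelianization (I : finType) (w : I -> ab_module) :
  (forall m, int_span w m) -> finitely_generated (abelianization G).
Proof.
move=> wspan; exists [seq w i | i <- enum I] => m; apply/gen_subgroupP => H [/set_mem H1 HV] Hw.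
have {}HV (x y : ab_module) : H x -> H y -> H (x - y).
  by move=> Hx Hy; apply/set_mem; apply: HV; apply/mem_set.
have HN (x : ab_module) : H x -> H (- x) by move=> Hx; rewrite -sub0r; apply: HV.
have HD (x y : ab_module) : H x -> H y -> H (x + y).
  by move=> Hx Hy; rewrite -[y]opprK; apply/HV/HN.
have [c ->] := wspan m; elim/big_ind: _ => // i _.
have wi : H (w i) by apply: Hw; apply: map_f; rewrite mem_enum.
have wn k : H (w i *+ k) by elim: k => // k IH; rewrite mulrS; apply: HD.
by case: (c i) => k; [exact: wn|rewrite NegzE mulrNz; apply/HN/wn].
Qed.

End Abelianization.

Section Kernel.
Local Open Scope quotient_scope.
Variables (G : groupType) (phi : UMagmaMorphism.type G G).
Local Notation S := (stable_image phi).
Variables (nS : normal_subgroup S) (n : nat) (c : G -> 'rV[int]_n) (F : 'M[int]_n).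
Hypotheses (phi_inj : injective phi) (G_fg : finitely_generated G).
Hypotheses (cM : forall x y, c (x * y)%g = c x + c y) (c0 : forall x, c x = 0 <-> x \in S).
Hypotheses (c_surj : forall u, exists x, c x = u) (cF : forall x, c (phi x) = c x *m F).
Local Notation K := (subgroup_type S).
Local Notation M := (ab_module K).

Definition conj_fun (y : G) (x : K) : K := exist _ (val x ^ y)%g (nS (valP x) y).

Lemma conj_funM y : {morph conj_fun y : a b / (a * b)%g}.
Proof. by move=> a b; apply: val_inj; rewrite /= conjMg. Qed.

Lemma phi_stable (x : K) : phi (val x) \in S.
Proof. by rewrite stable_image_phi ?(valP x). Qed.
Definition phi_fun (x : K) : K := exist _ (phi (val x)) (phi_stable x).
Lemma phi_funM : {morph phi_fun : a b / (a * b)%g}.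
Proof. by move=> a b; apply: val_inj; rewrite /= gmulfM. Qed.

Lemma phi_inv_ex : exists2 h : K -> K, cancel phi_fun h & cancel h phi_fun.
Proof.
have /boolp.choice[h hK] : forall x : K, exists y : K, x = phi_fun y.
  move=> x; have [y yS xy] := stable_image_onto phi_inj (valP x).
  by exists (exist _ y yS); apply: val_inj.
exists h => [x|x]; last exact/esym/hK.
by apply: val_inj; apply: phi_inj; have /(congr1 val) := hK (phi_fun x).
Qed.

(** Elements with the same class differ by an element of the stable image,
    which acts trivially on its own abelianization. *)
Lemma conj_fun_proj y y' x : c y = c y' -> ab_proj (conj_fun y x) = ab_proj (conj_fun y' x).
Proof.
move=> /(class_eq cM c0) yS; apply/ab_proj_eq.
have -> : ((conj_fun y x)^-1 * conj_fun y' x)%g =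
          [~ conj_fun y x, exist _ (y^-1 * y')%g yS : K]%g.
  by apply: val_inj; rewrite /= -[RHS]/([~ _, _]%g) commgEl -conjgM mulVKg.
exact: commutator_derived.
Qed.

(** The abelianized stable image is a module over the group ring of Z^n by
    conjugation, with [phi] acting bijectively and semilinearly. It is finitely
    generated: let [s] generate the group, let [z u] be a product of lifts of the
    basis vectors with class [u], and let [H'] be a normal subgroup containing
    the commutators of elements of [s] and the elements [(z (c x))^-1 * x] for [x]
    in [s]. The quotient by [H'] is abelian, and the image of any element in it
    depends only on its class; so [H'] contains the stable image. *)
Lemma kernel_abelianization_fg : contracting F -> \det F != 0 ->
  finitely_generated (abelianization K).
Proof.
move=> Fcap Fdet.
have /boolp.choice[l lP] := c_surj.
pose alpha u := ab_fun (conj_funM (l u)).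
have alphaE u y x : c y = u -> alpha u (ab_proj x) = ab_proj (conj_fun y x).
  by move=> yu; rewrite ab_funE; apply: conj_fun_proj; rewrite lP.
have alphaP : is_action alpha.
  split=> [m|u v m]; have [x ->] := ab_proj_surj m.
    rewrite (@alphaE _ 1%g) ?(class1 cM)//; congr ab_proj; apply: val_inj; exact: conjg1.
  rewrite addrC (@alphaE _ (l v * l u)%g) ?cM ?lP// (@alphaE v (l v))//.
  by rewrite (@alphaE u (l u))//; congr ab_proj; apply: val_inj; rewrite /= conjgM.
pose psi := ab_fun phi_funM.
have [h hK h'K] := phi_inv_ex.
have hM : {morph h : a b / (a * b)%g}.
  by move=> a b; apply: (can_inj hK); rewrite phi_funM !h'K.
pose psi' := ab_fun hM.
have psiK : cancel psi psi'.
  by move=> m; have [x ->] := ab_proj_surj m; rewrite /psi (ab_funE _ x) ab_funE hK.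
have psi'K : cancel psi' psi.
  by move=> m; have [x ->] := ab_proj_surj m; rewrite /psi' (ab_funE _ x) ab_funE h'K.
have psi_alpha u m : psi (alpha u m) = alpha (u *m F) (psi m).
  have [x ->] := ab_proj_surj m; rewrite (@alphaE u (l u))// /psi (ab_funE _ x) ab_funE.
  rewrite (@alphaE _ (phi (l u))) ?cF ?lP//; congr ab_proj; apply: val_inj.
  by rewrite /= gmulfJ.
suff [g gen] : exists g, additive_generates alpha g.
  have [I [w wspan]] := finitely_generated_of_shift Fcap Fdet psiK psi'K alphaP gen psi_alpha.
  exact: finitely_generated_abelianization wspan.
have [s sgen] := finitely_generated_ind G_fg.
(* The second condition says that [z] is a product of the lifts [l (delta_mx 0 j)]
   with exponents [u], in terms of maps into abelian groups. *)
have /boolp.choice[z zP] : forall u, exists z, c z = u /\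
    forall (Q : zmodType) (q : G -> Q), (forall x y, q (x * y)%g = q x + q y) ->
      q z = \sum_j q (l (delta_mx 0 j)) *~ u 0 j.
  have q1 (Q : zmodType) (q : G -> Q) : (forall x y, q (x * y)%g = q x + q y) -> q 1%g = 0.
    by move=> qM; apply: (addrI (q 1%g)); rewrite -qM mulg1 addr0.
  apply: row_int_ind => [|u v [x [xu xq]] [y [yv yq]]|i].
  - exists 1%g; split=> [|Q q qM]; first exact: (class1 cM).
    by rewrite q1// big1// => j _; rewrite mxE.
  - exists (x / y)%g; split=> [|Q q qM]; first by rewrite cM (classV cM) xu yv.
    have qV : q (y^-1)%g = - q y by apply: (addrI (q y)); rewrite -qM mulgV q1// subrr.
    rewrite qM qV xq// yq// -sumrB; apply: eq_bigr => j _.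
    by rewrite !mxE mulrzBr.
  - exists (l (delta_mx 0 i)); split=> [//|Q q qM].
    rewrite (bigD1 i)//= mxE !eqxx big1 ?addr0// => j ji.
    by rewrite mxE (negPf ji) andbF.
pose toK (x : G) : K := insubd (1%g : K) x.
have toKE x : x \in S -> val (toK x) = x by move=> xS; rewrite val_insubd xS.
pose cand := [seq [~ x, y]%g | x <- s, y <- s] ++ [seq ((z (c x))^-1 * x)%g | x <- s].
exists [seq ab_proj (toK x) | x <- cand] => H H0 HB Ha Hg.
pose H' x := x \in S /\ H (ab_proj (toK x)).
have candH x : x \in S -> x \in cand -> H' x.
  by move=> xS xc; split=> //; apply: Hg; apply: map_f.
have toK1 : toK 1%g = 1%g by apply: val_inj; rewrite toKE ?gpred1.
have H'1 : H' 1%g by split; [exact: gpred1|rewrite toK1 ab_proj1].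
have H'F x y : H' x -> H' y -> H' (x / y)%g.
  move=> [xS Hx] [yS Hy]; have xyS : (x / y)%g \in S by apply: gpredF.
  split=> //; have -> : toK (x / y)%g = (toK x / toK y)%g.
    by apply: val_inj; rewrite gmulfF /= !toKE.
  by rewrite ab_projM ab_projV; apply: HB.
have H'J x y : H' x -> H' (x ^ y)%g.
  move=> [xS Hx]; have xyS : (x ^ y)%g \in S by apply: nS.
  split=> //; have -> : toK (x ^ y)%g = conj_fun y (toK x) by apply: val_inj; rewrite /= !toKE.
  by rewrite -(@alphaE (c y) y)//; apply: Ha.
pose P : {pred G} := [pred x | `[< H' x >]].
have inP x : x \in P <-> H' x by split=> /asboolP.
have Pgroup : group_closed P.
  by split=> [|x y /inP Hx /inP Hy]; apply/inP => //; apply: H'F.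
pose N : groupClosed G := HB.pack P (isMulClosed.Build G P (group_closedM Pgroup))
  (isMul1Closed.Build G P Pgroup.1) (isInvClosed.Build G P (group_closedV Pgroup)).
have nN : normal_subgroup N by move=> x /inP Hx y; apply/inP/H'J.
have comm_gen x y : x \in s -> y \in s -> H' [~ x, y]%g.
  move=> xs ys; apply: candH; last by rewrite mem_cat allpairs_f.
  by apply/c0; rewrite !cM !(classV cM) [c x + c y]addrC addKr addNr.
pose p x := \pi_(quotient_group nN) x.
have pM x y : p (x * y)%g = (p x * p y)%g := pi_quotient_mulM nN x y.
have p1 : p 1%g = 1%g by apply: (mulgI (p 1%g)); rewrite -pM !mulg1.
have pF x y : p (x / y)%g = (p x / p y)%g by apply: (mulIg (p y)); rewrite -pM !mulgVK.
have p_comm x y : H' [~ x, y]%g -> commute (p y) (p x).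
  move=> /inP xy; rewrite /commute -!pM; apply/eqP.
  by rewrite (quotient_eqE nN) invgM -mulgA.
have commF (a b d : quotient_group nN) : commute d a -> commute d b -> commute d (a / b)%g.
  by move=> da db; apply: commuteM => //; apply: commuteV.
have abQ : abelian_group (quotient_group nN).
  have com x y : commute (p y) (p x).
    elim/sgen: x => [|x x' xy x'y|x xs].
    - by rewrite p1; apply: commute1.
    - by rewrite pF; apply: commF.
    apply: commute_sym; elim/sgen: y => [|y y' xy xy'|y ys]; last exact/p_comm/comm_gen.
      by rewrite p1; apply: commute1.
    by rewrite pF; apply: commF.
  by move=> a b; have := com (repr b) (repr a); rewrite /p !reprK.
pose q x := cls abQ x.
have qM : forall x y, q (x * y)%g = q x + q y by apply: clsM.
have q0 x : q x = 0 <-> H' x by rewrite (cls_eq0 abQ); apply: inP.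
have qc x : q x = \sum_j q (l (delta_mx 0 j)) *~ c x 0 j.
  elim/sgen: x => [|x y qx qy|x xs].
  - by rewrite /q cls1 (class1 cM) big1// => j _; rewrite mxE.
  - rewrite qM /q clsV -/(q x) -/(q y) qx qy -sumrB; apply: eq_bigr => j _.
    by rewrite cM (classV cM) !mxE mulrzBr.
  - have [zx zq] := zP (c x); rewrite -(zq _ _ qM).
    have zS : ((z (c x))^-1 * x)%g \in S by apply/c0; rewrite cM (classV cM) zx addNr.
    have : H' ((z (c x))^-1 * x)%g.
      by apply: candH => //; rewrite mem_cat orbC; apply/orP; left; apply/mapP; exists x.
    by move=> /q0; rewrite qM /q clsV => /eqP; rewrite addrC subr_eq0 => /eqP.
move=> m; have [x ->] := ab_proj_surj m.
have : H' (val x).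
  by apply/q0; rewrite qc (c0 _).2 ?(valP x)// big1// => j _; rewrite mxE.
by move=> [_]; rewrite (_ : toK (val x) = x)//; apply: val_inj; rewrite toKE ?(valP x).
Qed.

End Kernel.

(** * The theorem *)

Local Close Scope ring_scope.
Unset Implicit Arguments.
Local Open Scope classical_set_scope.
Local Open Scope card_scope.

Theorem corollary2 (pi : groupType) (phi : UMagmaMorphism.type pi pi)
    (pi_fg : finitely_generated pi)
    (phi_inj : injective phi)
    (index_gt1 : ~~ (left_cosets (range phi) #<= `I_1))
    (G_normal : normal_subgroup (stable_image phi))
    (quotient_abelian : abelian_group (quotient_group G_normal)) :
  [/\ exists2 n : nat, (0 < n)%N &
        isomorphic (quotient_group G_normal) (free_abelian n),
      finite_set (left_cosets (range phi)) &
      finitely_generated (abelianization (subgroup_type (stable_image phi)))].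
Proof.
have [n [c [F [[cM c0] c_surj cF Fcap Fdet]]]] :=
  class_map_ex phi_inj pi_fg quotient_abelian.
split; last exact: (kernel_abelianization_fg G_normal phi_inj pi_fg cM c0 c_surj cF Fcap Fdet).
- exists n; first exact: (class_rank_gt0 c0 index_gt1).
  exact: (quotient_isomorphic G_normal cM c0 c_surj).
- exact: (finite_cosets cM c0 c_surj cF Fdet).
Qed.
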